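(* Suppose $h$ is continuous on $[0,M)$ and, for $i=1,2$, let $(\overline X^{(i)},\overline\nu^{(i)})$ be the solution to the fluid equations associated with $(\overline E^{(i)},\overline X^{(i)}(0),\overline\nu^{(i)}_0)\in\mathcal S_0$ and $h$, and let $\overline K^{(i)}(t)=\langle\mathbf 1,\overline\nu^{(i)}_t\rangle-\langle\mathbf 1,\overline\nu_0^{(i)}\rangle+\int_0^t\langle h,\overline\nu_s^{(i)}\rangle ds$ and $\overline D^{(i)}(t)=\int_0^t\langle h,\overline\nu_s^{(i)}\rangle ds$. Write $\Delta H\doteq H^{(2)}-H^{(1)}$ for $H=\overline K,\overline D,\overline E,\overline X,\overline\nu$. If $\overline\nu^{(1)}_0=\overline\nu^{(2)}_0$, then for every $T<\infty$, $$\Big[\sup_{t\in[0,T]}\Delta\overline K(t)\Big]\vee\Big[\sup_{t\in[0,T]}\Delta\overline D(t)\Big]\le\Big[\Delta\overline X(0)+\sup_{t\in[0,T]}\Delta\overline E(t)\Big]\vee0,$$ and hence $$\|\Delta\overline K\|_T\vee\|\Delta\overline D\|_T\le|\Delta\overline X(0)|+\|\Delta\overline E\|_T.$$ Moreover, for every $T<\infty$ and every $f\in\mathcal C^1_b(\mathbb R_+)$, $$\sup_{s\in[0,T]}\big|\langle f,\overline\nu_s^{(2)}\rangle-\langle f,\overline\nu_s^{(1)}\rangle\big|\le\big(2\|f\|_T+\|f'\|_T\big)\big(|\Delta\overline X(0)|+\|\Delta\overline E\|_T\big).$$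
   Context: $G$ is a cumulative distribution function on $[0,\infty)$ with density $g$ and mean $1$; $M\doteq\sup\{x\ge0:G(x)<1\}\in(0,\infty]$; $h\doteq g/(1-G)$ on $[0,M)$ is the hazard rate. $\mathbb R_+=[0,\infty)$; $\|\psi\|_T\doteq\sup_{s\in[0,T]}|\psi(s)|$; $\mathcal C_b^1(\mathbb R_+)$ is the space of continuously differentiable functions on $\mathbb R_+$ that are bounded together with their first derivative; $\mathbf 1$ is the constant function $1$; $\langle f,\xi\rangle\doteq\int_{[0,M)}f\,d\xi$. $\mathcal M_{\le1}[0,M)$ is the space of sub-probability measures on $[0,M)$ with the weak topology. $\mathcal I_{\mathbb R_+}[0,\infty)$ is the set of non-decreasing càdlàg $f:[0,\infty)\to\mathbb R_+$ with $f(0)=0$. $\mathcal S_0\doteq\{(f,x,\mu)\in\mathcal I_{\mathbb R_+}[0,\infty)\times\mathbb R_+\times\mathcal M_{\le1}[0,M):1-\langle\mathbf 1,\mu\rangle=[1-x]^+\}$. Fluid equations: a càdlàg $(\overline X,\overline\nu)$ with values in $\mathbb R_+\times\mathcal M_{\le1}[0,M)$ solves the fluid equations associated with $(\overline E,\overline X(0),\overline\nu_0)\in\mathcal S_0$ and $h$ if for every $t\ge0$, $\int_0^t\langle h,\overline\nu_s\rangle ds<\infty$, and for every continuously differentiable compactly supported $\varphi$ on $[0,M)\times\mathbb R_+$, $$\langle\varphi(\cdot,t),\overline\nu_t\rangle=\langle\varphi(\cdot,0),\overline\nu_0\rangle+\int_0^t\langle\varphi_s(\cdot,s)+\varphi_x(\cdot,s),\overline\nu_s\rangle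 ds-\int_0^t\langle h(\cdot)\varphi(\cdot,s),\overline\nu_s\rangle ds+\int_0^t\varphi(0,s)\,d\overline K(s),$$ $$\overline X(t)=\overline X(0)+\overline E(t)-\int_0^t\langle h,\overline\nu_s\rangle ds,\qquad 1-\langle\mathbf 1,\overline\nu_t\rangle=[1-\overline X(t)]^+,$$ where $\overline K(t)=\langle\mathbf 1,\overline\nu_t\rangle-\langle\mathbf 1,\overline\nu_0\rangle+\int_0^t\langle h,\overline\nu_s\rangle ds$; integrals against $d\overline K$ are Riemann–Stieltjes integrals over $[0,t]$. *)

(* Defs.v *)
From HB Require Import structures.
From mathcomp Require Import all_boot all_order all_algebra.
From mathcomp Require Import all_classical all_reals all_analysis.

Set Implicit Arguments.
Unset Strict Implicit.
Unset Printing Implicit Defensive.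

Import Order.TTheory GRing.Theory Num.Theory.
Import numFieldNormedType.Exports.

Local Open Scope classical_set_scope.
Local Open Scope ring_scope.

(* Functions and trajectories on [0, oo) are total functions on R that are only
   ever constrained at nonnegative arguments. *)
Section fluid_model.
Context {R : realType}.
Implicit Types (G g h f E X : R -> R) (M : \bar R).

Local Notation leb := (@lebesgue_measure R).
Local Notation sprob := (subprobability (measurableTypeR R) R).

(* G is a cumulative distribution function on [0, oo) with density g, mean 1. *)
Definition service_distribution G g : Prop :=
  [/\ measurable_fun (`[0, +oo[ : set R) g,
      forall x, 0 <= x -> 0 <= g x,
      (\int[leb]_(x in `[0%R, +oo[) (g x)%:E = 1)%E,
      forall x, 0 <= x -> (G x)%:E = (\int[leb]_(y in `[0%R, x]) (g y)%:E)%E &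
      (\int[leb]_(x in `[0%R, +oo[) (x * g x)%:E = 1)%E].

Definition right_end G : \bar R :=
  ereal_sup [set x%:E | x in [set x | 0 <= x /\ G x < 1]].

Definition hazard G g : R -> R := fun x => g x / (1 - G x).

Definition ages M : set R := [set x | 0 <= x /\ (x%:E < M)%E].

(* Sub-probability measures on [0, M) are encoded as Borel sub-probability
   measures on R that do not charge the complement of [0, M). *)
Definition on_ages M (mu : sprob) : Prop := mu (~` ages M) = 0%E.

Definition pairing M f (mu : sprob) : R := \int[mu]_(x in ages M) f x.

(* Convergence along F in the weak topology of measures on the space [0, M):
   the test functions need only be continuous and bounded on [0, M), so no
   mass may escape to M in the limit. *)
Definition weak_cvg M (F : set_system R) (nu : R -> sprob) (mu : sprob) : Prop :=
  forall f, {within ages M, continuous f} -> [bounded f x | x in ages M] ->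
    pairing M f (nu s) @[s --> F] --> pairing M f mu.

Definition cadlag (X : R -> R) : Prop :=
  (forall t, 0 <= t -> X s @[s --> t^'+] --> X t) /\
  (forall t, 0 < t -> cvg (X s @[s --> t^'-])).

Definition weak_cadlag M (nu : R -> sprob) : Prop :=
  (forall t, 0 <= t -> weak_cvg M t^'+ nu (nu t)) /\
  (forall t, 0 < t -> exists mu : sprob, on_ages M mu /\ weak_cvg M t^'- nu mu).

(* The class of nondecreasing cadlag functions [0, oo) -> [0, oo) null at 0. *)
Definition input_process E : Prop :=
  [/\ E 0 = 0, forall s t, 0 <= s -> s <= t -> E s <= E t & cadlag E].

Definition initial_data M E (x : R) (mu : sprob) : Prop :=
  [/\ input_process E, 0 <= x, on_ages M mu &
      1 - pairing M (cst 1) mu = Num.max (1 - x) 0].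

(* Derivative at x relative to A (one-sided at an endpoint of an interval). *)
Definition derivative_within (A : set R) f (x l : R) : Prop :=
  (f y - f x) / (y - x) @[y --> within A x^'] --> l.

Definition age_time M : set (R * R) := [set z | ages M z.1 /\ 0 <= z.2].

(* phi(x, s) is a continuously differentiable, compactly supported function on
   [0, M) x [0, oo) with partial derivatives phix and phis; the support is
   compact in [0, M) x [0, oo), hence may meet x = 0 and s = 0 but stays away
   from x = M. *)
Definition test_function M (phi phix phis : R -> R -> R) : Prop :=
  [/\ forall x s, age_time M (x, s) ->
        derivative_within (ages M) (fun y => phi y s) x (phix x s),
      forall x s, age_time M (x, s) ->
        derivative_within `[0, +oo[ (fun r => phi x r) s (phis x s),
      {within age_time M, continuous (fun z => phix z.1 z.2)},
      {within age_time M, continuous (fun z => phis z.1 z.2)} &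
      exists C : set (R * R), [/\ compact C, C `<=` age_time M &
        forall x s, age_time M (x, s) -> ~ C (x, s) -> phi x s = 0]].

(* I is the Riemann-Stieltjes integral of f with respect to K over [a, b]:
   the limit of tagged sums as the mesh goes to 0. *)
Definition is_RS_integral f (K : R -> R) (a b I : R) : Prop :=
  forall e, 0 < e -> exists2 d, 0 < d &
    forall (s : seq R) (xi : nat -> R), itv_partition a b s ->
      let p := nth b (a :: s) in
      (forall i, (i < size s)%N ->
         p i.+1 - p i < d /\ p i <= xi i <= p i.+1) ->
      `|\sum_(0 <= i < size s) f (xi i) * (K (p i.+1) - K (p i)) - I| < e.

Definition departure_ext M h (nu : R -> sprob) (t : R) : \bar R :=
  (\int[leb]_(s in `[0%R, t]) \int[nu s]_(x in ages M) (h x)%:E)%E.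

Definition departure M h (nu : R -> sprob) (t : R) : R :=
  fine (departure_ext M h nu t).

Definition entry M h (nu : R -> sprob) (t : R) : R :=
  pairing M (cst 1) (nu t) - pairing M (cst 1) (nu 0) + departure M h nu t.

(* (X, nu) solves the fluid equations associated with (E, X 0, nu 0) and h. *)
Definition fluid_solution M h E X (nu : R -> sprob) : Prop :=
  [/\ cadlag X /\ (forall t, 0 <= t -> 0 <= X t),
      weak_cadlag M nu /\ (forall t, 0 <= t -> on_ages M (nu t)),
      forall t, 0 <= t -> (departure_ext M h nu t < +oo)%E,
      forall phi phix phis, test_function M phi phix phis ->
        forall t, 0 <= t -> exists2 I : R,
          is_RS_integral (fun s => phi 0 s) (entry M h nu) 0 t I &
          pairing M (fun x => phi x t) (nu t) =
            pairing M (fun x => phi x 0) (nu 0)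
            + \int[leb]_(s in `[0, t])
                pairing M (fun x => phis x s + phix x s) (nu s)
            - \int[leb]_(s in `[0, t])
                pairing M (fun x => h x * phi x s) (nu s)
            + I &
      forall t, 0 <= t ->
        X t = X 0 + E t - departure M h nu t /\
        1 - pairing M (cst 1) (nu t) = Num.max (1 - X t) 0].

(* f is C^1 on [0, oo) with derivative f', both bounded. *)
Definition C1_bounded f f' : Prop :=
  [/\ forall x, 0 <= x -> derivative_within `[0, +oo[ f x (f' x),
      {within `[0, +oo[, continuous f'},
      [bounded f x | x in `[0, +oo[] &
      [bounded f' x | x in `[0, +oo[]].

(* Suprema over [0, T] are taken in the extended reals, so that no junk value
   arises for unbounded functions. *)
Definition sup_upto (T : R) f : \bar R := ereal_sup [set (f t)%:E | t in `[0, T]].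

Definition norm_upto (T : R) f : \bar R := sup_upto T (fun t => `|f t|).

End fluid_model.

(* Main.v *)
Require Import Defs.
From HB Require Import structures.
From mathcomp Require Import all_boot all_order all_algebra.
From mathcomp Require Import all_classical all_reals all_analysis.
From mathcomp Require Import measurable_realfun ring lra.
Import Order.TTheory GRing.Theory Num.Theory.
Import numFieldNormedType.Exports.
Local Open Scope classical_set_scope.
Local Open Scope ring_scope.

Set Implicit Arguments.
Unset Strict Implicit.
Unset Printing Implicit Defensive.

(** The two balance equations determine the cumulative entry K once D is known:
since the mass of nu_t is min(1, X t) and X = X 0 + E - D,
  K t = min(1 + D t, X 0 + E t) - <1, nu_0>,
so K is nondecreasing.  Writing Delta for solution 2 minus solution 1, two
cases arise at a time t.  If X1 t < 1, then Delta K t <= Delta X 0 + Delta E t.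
If X1 t >= 1, then nu1_t has full mass 1 and Delta K t <= Delta D t.  What
closes the argument is a renewal formula that expresses Delta D through the
past of Delta K,
  Delta D t = int_0^t g(s) Delta K(t - s) ds,
because it turns the dichotomy into
  Delta K t <= max(c, int_0^t g(s) Delta K(t - s) ds),
and a function satisfying this with a density g of mass at most 1 cannot exceed
c ([renewal_inequality]); then Delta D <= c by the renewal formula once more.

The renewal formula is the case f = 1 of the representation
([pairing_difference])
  <f, Delta nu_t> = f(0) Delta K t
                    + int_0^t Delta K(t - s) (f (1 - G))'(s) ds,
which also gives the last estimate: |(f (1 - G))'| <= |f'| (1 - G) + |f| g, where
g has integral 1 and 1 - G has integral equal to the mean, which is 1
([integral_survival_le1]).

The representation comes from transporting along characteristics.  For w of
class C^1 vanishing near and beyond M, the function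
  phi(x, s) = w(x + t - s) / (1 - G x)
satisfies phi_s + phi_x = h phi on [0, t], so that the two drift integrals of the
fluid equation cancel and only the terms at times 0 and t and the integral
against dK survive ([fluid_transport]).  A cutoff in s makes the support
compact.  As K is monotone, the Stieltjes integral can be integrated by parts
against the C^1 function w ([RS_integral_by_parts]).  The choice wanted is
w = f (1 - G), which does not vanish near M; it is the limit, as e tends to 0, of
f ((1 - G - e)^+)^2 / (1 - G), which is C^1 and vanishes where 1 - G <= e, and
dominated convergence gives the formula ([fluid_trunc_limit]).  The terms
containing nu_0 need no evaluation, being the same for both solutions. *)

(** * One-sided derivatives and extension to the negative axis *)

Section calculus.
Context {R : realType}.
Implicit Types (F f w v : R -> R) (A : set R) (x y l : R).

Lemma dnbhs_shift x (P : set R) :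
  (\forall h \near 0^', P h) <-> (\forall y \near x^', P (y - x)).
Proof.
rewrite !near_withinE.
have E : (\forall h \near (0 : R), h != 0 -> P h) <->
    (\forall y \near x, y - x != 0 -> P (y - x)).
  rewrite (near_shift x (0 : R) (fun h => h != 0 -> P h)).
  by split; apply: filterS => y /=; rewrite sub0r.
by split => [/E|H]; last apply/E; apply: filterS H || apply: filterS;
  move=> y /=; rewrite subr_eq0.
Qed.

(** Both ways of writing a derivative are used: calculus rules are available for
increments h tending to 0, while relative derivatives are limits over the
second point y. *)
Lemma is_derive_quotient F x l :
  is_derive x 1 F l <-> (F y - F x) / (y - x) @[y --> x^'] --> l.
Proof.
have E : (h^-1 *: ((F \o shift x) (h *: 1) - F x) @[h --> 0^'] --> l) <->
    ((F y - F x) / (y - x) @[y --> x^'] --> l).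
  split => /cvgrPdist_lt H; apply/cvgrPdist_lt => e e0; have := H _ e0.
    move=> /(@dnbhs_shift x); apply: filterS => y.
    by rewrite /shift/= [_%:A]mulr1 subrK mulrC.
  move=> H'; apply/(@dnbhs_shift x); apply: filterS H' => y.
  by rewrite /shift/= [_%:A]mulr1 subrK mulrC.
split.
  by move=> [dF dl]; apply/E; rewrite -dl; exact: dF.
move=> /E H; split; first by apply/cvg_ex; exists l.
by apply/cvg_lim => //; exact: Rhausdorff.
Qed.

Lemma is_derive_within {A F x l} : is_derive x 1 F l -> derivative_within A F x l.
Proof.
move=> /is_derive_quotient; rewrite /derivative_within.
by apply: cvg_trans; apply: cvg_app; exact: cvg_within.
Qed.

Lemma derivative_within_interior A F x l : nbhs x A ->
  derivative_within A F x l -> is_derive x 1 F l.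
Proof.
move=> xA /cvgrPdist_lt H; apply/is_derive_quotient/cvgrPdist_lt => e e0.
have := H _ e0; rewrite !near_withinE => {}H.
by apply: filterS2 xA H => y Ay + yx; apply.
Qed.

(** Continuing a function on the half line by its tangent at 0 preserves class C^1,
so that a transported profile makes sense at negative ages. *)
Definition extend_linear F l x : R := if x < 0 then F 0 + l * x else F x.

Lemma is_derive_linear (a b x : R) : is_derive x 1 (fun y => a + b * y) b.
Proof.
apply/is_derive_quotient.
apply: (@cvg_trans _ (cst b @ x^')); last exact: cvg_cst.
apply: near_eq_cvg; near=> y; rewrite /cst/=.
have yx : y - x != 0 by rewrite subr_eq0; near: y; exact: nbhs_dnbhs_neq.
by field.
Unshelve. all: by end_near. Qed.

Lemma is_derive_extend_linear F (F' : R -> R) :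
  (forall x, 0 <= x -> derivative_within `[0, +oo[ F x (F' x)) ->
  forall x, is_derive x 1 (extend_linear F (F' 0)) (F' (Num.max x 0)).
Proof.
move=> H x; case: (ltgtP x 0) => [x0|x0|->].
- apply: near_eq_is_derive (is_derive_linear (F 0) _ _).
  near=> y; rewrite /extend_linear ifT//; near: y; exact: lt_nbhsl.
- apply: (@near_eq_is_derive _ _ _ F).
    near=> y; rewrite /extend_linear ifF//; apply/negbTE; rewrite -leNgt.
    apply: ltW; near: y; exact: lt_nbhsr.
  apply: (@derivative_within_interior `[0, +oo[); last by apply: H; exact: ltW.
  near=> y; rewrite /= in_itv/= andbT.
  apply: ltW; near: y; exact: lt_nbhsr.
- apply/is_derive_quotient/cvgrPdist_lt => e e0.
  have /cvgrPdist_lt/(_ _ e0) := H 0 (lexx _).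
  rewrite !near_withinE; apply: filterS => y; rewrite /= in_itv/= => He y0.
  have := He y0; rewrite /extend_linear ltxx andbT.
  case: (ltP y 0) => [yl _|y0']; last by apply.
  by rewrite addrAC subrr add0r subr0 mulfK// subrr normr0.
Unshelve. all: by end_near. Qed.

Lemma continuous_max0 : continuous (fun x : R => Num.max x 0).
Proof.
move=> x; have -> : (fun x : R => Num.max x 0) = (fun x => (x + `|x|) / 2).
  apply/funext => y; case: leP => y0; last by rewrite gtr0_norm//; lra.
  by rewrite ler0_norm//; lra.
apply: cvgMl; apply: cvgD; first exact: cvg_id.
exact: norm_continuous.
Qed.

(** The square makes the positive part C^1; it is the building block of all cutoffs
below. *)
Definition sqr_pos x : R := Num.max x 0 ^+ 2.

Lemma is_derive_sqr_pos x : is_derive x 1 sqr_pos (2 * Num.max x 0).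
Proof.
have -> : sqr_pos = extend_linear (fun y => y ^+ 2) 0.
  apply/funext => y; rewrite /sqr_pos /extend_linear; case: (ltP y 0) => y0.
    by rewrite expr0n mul0r addr0.
  by [].
rewrite -[X in extend_linear _ X](mulr0 2).
apply: (@is_derive_extend_linear _ (fun y => 2 * y)) => y _.
apply: is_derive_within; apply: is_derive_eq; rewrite /GRing.scale/=; ring.
Qed.

End calculus.

(** * Integration by parts for Stieltjes integrals of monotone functions *)

Section integrability.
Context d (T : measurableType d) (R : realType) (mu : {measure set T -> \bar R}).

Lemma bounded_integrable (A : set T) (f : T -> R) (C : R) :
  measurable A -> (mu A < +oo)%E -> measurable_fun A f ->
  (forall x, A x -> `|f x| <= C) -> mu.-integrable A (EFin \o f).
Proof.
move=> mA muA mf fC; apply: measurable_bounded_integrable => //.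
exists C; split; first exact: num_real.
by move=> y Cy x Ax; apply: (le_trans (fC _ Ax)); exact: ltW.
Qed.

Lemma integrable_scale (A : set T) (f : T -> R) (r : R) : measurable A ->
  mu.-integrable A (EFin \o f) -> mu.-integrable A (EFin \o (fun x => r * f x)).
Proof. by move=> mA fi; exact: (integrableZl mA r fi). Qed.

Lemma integrable_sub (A : set T) (f g : T -> R) : measurable A ->
  mu.-integrable A (EFin \o f) -> mu.-integrable A (EFin \o g) ->
  mu.-integrable A (EFin \o (fun x => f x - g x)).
Proof. by move=> mA fi gi; exact: (integrableB mA fi gi). Qed.

Lemma integrable_add (A : set T) (f g : T -> R) : measurable A ->
  mu.-integrable A (EFin \o f) -> mu.-integrable A (EFin \o g) ->
  mu.-integrable A (EFin \o (fun x => f x + g x)).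
Proof. by move=> mA fi gi; exact: (integrableD mA fi gi). Qed.

End integrability.

Section riemann_stieltjes.
Context {R : realType}.
Local Notation leb := (@lebesgue_measure R).
Implicit Types (K w v k : R -> R) (a b t x y : R).

Lemma lebesgue_itv_lty a b (c e : bool) :
  (leb [set` Interval (BSide c a) (BSide e b)] < +oo)%E.
Proof.
by rewrite lebesgue_measure_itv/=; case: ifP => // _; rewrite -EFinB ltry.
Qed.

Lemma lebesgue_itv_oc a b : a <= b -> leb `]a, b] = (b - a)%:E.
Proof.
rewrite lebesgue_measure_itv/= lte_fin le_eqVlt => /predU1P[->|->//].
by rewrite ltxx subrr.
Qed.

Lemma continuous_bounded_itv v a b : continuous v ->
  exists2 L, 0 <= L & forall x, a <= x <= b -> `|v x| <= L.
Proof.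
move=> cv; have [ab|ba] := leP a b; last first.
  exists 0 => // x /andP[ax xb].
  by have := lt_le_trans ba (le_trans ax xb); rewrite ltxx.
have [c _ Hc] : exists2 c, c \in `[a, b] &
    forall t, t \in `[a, b] -> `|v t| <= `|v c|.
  apply: (@EVT_max _ (fun x => `|v x|)) => //.
  apply: continuous_subspaceT => x.
  exact: (@continuous_comp _ _ _ v (fun y => `|y|) x (cv x) (@norm_continuous _ _ _)).
by exists `|v c| => // x xab; apply: Hc; rewrite in_itv.
Qed.

(** Monotone functions are measurable and bounded on a bounded interval, which is
all the regularity that the entry process provides. *)
Lemma monotone_continuous_integrable k v a b (c e : bool) :
  {homo k : x y / x <= y >-> y <= x} -> continuous v ->
  leb.-integrable [set` Interval (BSide c a) (BSide e b)] (EFin \o (fun s => k s * v s)).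
Proof.
move=> hk cv; have [L L0 HL] := continuous_bounded_itv a b cv.
apply: (@bounded_integrable _ _ R leb _ (fun s => k s * v s)
  ((`|k a| + `|k b|) * L)) => //.
- exact: lebesgue_itv_lty.
- apply: measurable_funM; first exact: measurable_realfun.nonincreasing_measurable.
  by apply: subspace_continuous_measurable_fun => //; exact: continuous_subspaceT.
- move=> x xab.
  have /andP[ax xb] : a <= x <= b.
    by move: xab; rewrite /= in_itv/=; case: (c); case: (e) => /= /andP[];
      do ?move/ltW; move=> -> //; do ?move/ltW.
  rewrite normrM ler_pM//; last by apply: HL; rewrite ax.
  have := hk _ _ ax; have := hk _ _ xb => h1 h2.
  have := ler_norm (k a); have := ler_norm (- k b); rewrite normrN => h3 h4.
  have := normr_ge0 (k a); have := normr_ge0 (k b) => h5 h6.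
  by rewrite ler_norml; apply/andP; split; lra.
Qed.

Lemma is_derive_continuous w v : (forall x, is_derive x 1 w (v x)) -> continuous w.
Proof.
move=> H x; apply: differentiable_continuous; apply/derivable1_diffP.
by have [] := H x.
Qed.

Lemma FTC2_C1 w v a b : a <= b -> (forall x, is_derive x 1 w (v x)) ->
  continuous v -> \int[leb]_(x in `]a, b]) v x = w b - w a.
Proof.
rewrite le_eqVlt => /predU1P[<- _ _|ab dw cv].
  by rewrite set_itv_ge ?bnd_simp// Rintegral_set0 subrr.
have cw := is_derive_continuous dw.
rewrite Rintegral_itv_obnd_cbnd; last first.
  apply: (@integrableS _ _ R leb `[a, b]) => //; first exact: subset_itv_oc_cc.
  apply: continuous_compact_integrable; first exact: segment_compact.
  exact: continuous_subspaceT.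
rewrite /Rintegral (@continuous_FTC2 _ v w)//.
- exact: continuous_subspaceT.
- split; first by move=> x _; have [] := dw x.
  + by apply: cvg_at_right_filter; exact: cw.
  + by apply: cvg_at_left_filter; exact: cw.
- by move=> x _; rewrite derive1E; exact: derive_val.
Qed.

(** Both terms are integrals of v over the same interval, weighted by the constant
k b and by k; by monotonicity these weights differ by at most k a - k b. *)
Lemma monotone_step k w v a b L : a <= b ->
  {homo k : x y / x <= y >-> y <= x} ->
  (forall x, is_derive x 1 w (v x)) -> continuous v ->
  (forall x, a <= x <= b -> `|v x| <= L) ->
  `|k b * (w b - w a) - \int[leb]_(x in `]a, b]) (k x * v x)|
    <= L * (b - a) * (k a - k b).
Proof.
move=> ab hk dw cv HL.
have iv : leb.-integrable `]a, b] (EFin \o v).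
  apply: (@integrableS _ _ R leb `[a, b]) => //; first exact: subset_itv_oc_cc.
  apply: continuous_compact_integrable; first exact: segment_compact.
  exact: continuous_subspaceT.
rewrite -(FTC2_C1 ab dw cv) -RintegralZl//.
rewrite -RintegralB//; first last.
- exact: monotone_continuous_integrable.
- exact: integrable_scale.
rewrite (_ : L * _ * _ = \int[leb]_(x in `]a, b]) (L * (k a - k b))); last first.
  rewrite Rintegral_cst//; have := lebesgue_itv_oc ab.
  by rewrite [X in X = _ -> _ = _ * fine X]/= => ->; rewrite /=; ring.
have ikv : leb.-integrable `]a, b] (EFin \o (fun x => k b * v x - k x * v x)).
  apply: integrable_sub => //; last exact: monotone_continuous_integrable.
  exact: integrable_scale.
apply: le_trans (le_normr_Rintegral _ ikv) _ => //.
apply: le_Rintegral => //.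
- by apply: integrable_norm.
- apply: (@bounded_integrable _ _ _ leb _ _ `|L * (k a - k b)|) => //.
  exact: lebesgue_itv_lty.
- move=> x /=; rewrite in_itv/= => /andP[/ltW ax xb].
  rewrite -mulrBl normrM mulrC ler_pM//; first by apply: HL; rewrite ax.
  have := hk _ _ ax; have := hk _ _ xb => h1 h2.
  by rewrite ler0_norm; lra.
Qed.

(** The errors of the successive steps telescope through the variation of k, which
leaves the mesh d as the only small factor. *)
Lemma monotone_sum_approx k w v (p : nat -> R) t L d n :
  {homo k : x y / x <= y >-> y <= x} ->
  (forall x, is_derive x 1 w (v x)) -> continuous v ->
  (forall x, 0 <= x <= t -> `|v x| <= L) -> 0 <= L ->
  p 0%N = 0 -> (forall i, p i <= p i.+1 <= p i + d) -> p n <= t ->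
  `|\sum_(0 <= j < n) k (p j.+1) * (w (p j.+1) - w (p j))
    - \int[leb]_(x in `[0, p n]) (k x * v x)| <= L * d * (k 0 - k (p n)).
Proof.
move=> hk dw cv HL L0 p0 hp.
have pge i : 0 <= p i.
  elim: i => [|i ih]; first by rewrite p0.
  by have /andP[+ _] := hp i; exact: (le_trans ih).
elim: n => [_|n ih pn].
  rewrite big_geq// p0 sub0r set_itv1 Rintegral_set1 oppr0 normr0.
  by rewrite subrr mulr0.
have /andP[h1 h2] := hp n.
have {}ih := ih (le_trans h1 pn).
rewrite big_nat_recr//=.
have := @Rintegral_itvB R (fun x => k x * v x) (BLeft 0) (BRight (p n.+1)) (p n).
move=> /(_ (monotone_continuous_integrable _ _ _ _ hk cv)).
rewrite !bnd_simp => /(_ (pge _) h1)/eqP; rewrite subr_eq addrC => /eqP ->.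
have HL' x : p n <= x <= p n.+1 -> `|v x| <= L.
  move=> /andP[x1 x2]; apply: HL.
  by rewrite (le_trans (pge n) x1) (le_trans x2 pn).
have st := monotone_step h1 hk dw cv HL'.
have -> (a b c d' : R) : a + b - (c + d') = (a - c) + (b - d') by ring.
apply: (le_trans (ler_normD _ _)).
have hL : L * (p n.+1 - p n) * (k (p n) - k (p n.+1)) <=
    L * d * (k (p n) - k (p n.+1)).
  apply: ler_wpM2r; first by rewrite subr_ge0 hk.
  by apply: ler_wpM2l => //; lra.
have -> : L * d * (k 0 - k (p n.+1)) =
  L * d * (k 0 - k (p n)) + L * d * (k (p n) - k (p n.+1)) by ring.
by rewrite [leRHS]addrC; apply: lerD => //; exact: (le_trans st hL).
Qed.

(** Since the integral I is assumed to exist, it is enough to evaluate it along one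
family of tagged sums.  Uniform partitions are chosen because they are
symmetric under s |-> t - s: an Abel summation then produces directly the
convolution form, without a change of variables in the integral. *)
Lemma RS_integral_by_parts (a K w v : R -> R) t I : 0 <= t ->
  {homo K : x y / x <= y} ->
  (forall x, is_derive x 1 w (v x)) -> continuous v ->
  (forall s, 0 <= s <= t -> a s = w (t - s)) ->
  is_RS_integral a K 0 t I ->
  I = w 0 * K t - w t * K 0 + \int[leb]_(s in `[0, t]) (K (t - s) * v s).
Proof.
rewrite le_eqVlt => /predU1P[<-|t0] hK dw cv haw HI.
  rewrite set_itv1 Rintegral_set1 subrr addr0.
  apply/eqP; rewrite -normr_le0; apply/ler_addgt0Pr => e e0; rewrite add0r.
  have [d d0 /(_ [::] (fun=> 0))] := HI _ e0.
  rewrite /itv_partition/= big_geq// sub0r normrN => H.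
  by apply/ltW/H => //; split.
pose k s := K (t - s).
have hk : {homo k : x y / x <= y >-> y <= x}.
  by move=> x y xy; apply: hK; rewrite lerD2l lerN2.
have [L L0 HL] := continuous_bounded_itv 0 t cv.
apply/eqP; rewrite -subr_eq0 -normr_le0; apply/ler_addgt0Pr => e e0; rewrite add0r.
have e20 : 0 < e / 2 by rewrite divr_gt0.
have [d d0 Hd] := HI _ e20.
have kt : 0 <= k 0 - k t by rewrite subr_ge0 hk// ltW.
(* d1 is small enough both for the tagged sums and for the error bound of the
   previous lemma; the summand 1 guards against a vanishing denominator *)
pose d1 := Num.min d (e / 2 / (L * (k 0 - k t) + 1)).
have Lk : 0 < L * (k 0 - k t) + 1 by rewrite ltr_wpDl// mulr_ge0.
have d10 : 0 < d1 by rewrite lt_min d0 divr_gt0.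
pose N := Num.truncn (t / d1); pose n := N.+1.
pose h := t / n%:R.
have n0 : (0 : R) < n%:R by rewrite ltr0n.
have h0 : 0 < h by rewrite divr_gt0.
have hd1 : h < d1.
  rewrite ltr_pdivrMr// mulrC -ltr_pdivrMr//.
  by rewrite truncnS_gt.
pose p i := h * i%:R.
have p0 : p 0%N = 0 by rewrite /p mulr0.
have pn : p n = t by rewrite /p /h mulfVK// gt_eqF.
have pS i : p i.+1 = p i + h by rewrite /p -natr1 mulrDr mulr1.
have pnB i : (i <= n)%N -> t - p i = p (n - i)%N.
  by move=> iN; rewrite -pn /p natrB// mulrBr.
have pb i : (i <= n)%N -> 0 <= p i <= t.
  move=> iN; apply/andP; split; first by rewrite /p mulr_ge0// ltW.
  by rewrite -pn ler_wpM2l ?(ltW h0)// ler_nat.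
pose s := [seq p i | i <- iota 1 n].
have ss : size s = n by rewrite size_map size_iota.
have es : 0 :: s = [seq p i | i <- iota 0 n.+1] by rewrite /= p0.
have nths i : (i <= n)%N -> nth t (0 :: s) i = p i.
  move=> iN; rewrite es (nth_map 0%N) ?size_iota//.
  by rewrite nth_iota// ltnS.
have sP : itv_partition 0 t s.
  split.
    rewrite /s -p0 path_map.
    have : path ltn 0%N (iota 1 n) := iota_ltn_sorted 0 n.+1.
    by apply: sub_path => i j /= ij; rewrite /p ltr_pM2l// ltr_nat.
  by rewrite (last_nth t) ss nths// pn.
have /(_ s (fun i => p i.+1) sP) := Hd; rewrite ss => /(_ _)/wrap[].
  move=> i iN; rewrite !nths//; last exact: ltnW.
  rewrite pS addrAC subrr add0r (lt_le_trans hd1) ?ge_min ?lexx//.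
  by split=> //; rewrite lerDl ltW /=.
rewrite (_ : \sum_(0 <= i < n) _ = w 0 * k 0 - w t * k t +
    \sum_(0 <= j < n) k (p j.+1) * (w (p j.+1) - w (p j))); last first.
  (* reverse the order of summation, then sum by parts *)
  rewrite big_nat_rev.
  have -> : w 0 * k 0 - w t * k t =
      \sum_(0 <= j < n) (w (p j) * k (p j) - w (p j.+1) * k (p j.+1)).
    by under eq_bigr do rewrite -opprB; rewrite sumrN telescope_sumr// opprB p0 pn.
  rewrite -big_split/= big_nat_cond [RHS]big_nat_cond; apply: eq_bigr => i.
  rewrite andbT => /andP[_ iN]; rewrite add0n.
  have iN' := ltnW iN.
  rewrite -[nth t s _]/(nth t (0 :: s) (n - i.+1).+1).
  rewrite -subSn// subSS !nths ?leq_subr//.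
  rewrite haw; last exact/pb/leq_subr.
  have tp j : (j <= n)%N -> t - p (n - j)%N = p j by move=> jn; rewrite -pnB// subKr.
  by rewrite tp// /k !pnB// ?subSS; ring.
have hp i : p i <= p i.+1 <= p i + h by rewrite pS lexx lerDl ltW.
have := @monotone_sum_approx k w v p t L h n hk dw cv HL L0 p0 hp.
rewrite pn => /(_ (lexx _)).
set S := \sum_(0 <= j < n) _; set J := \int[leb]_(x in _) _ => H1 H2.
have LhK : L * h * (k 0 - k t) <= e / 2.
  rewrite mulrAC; apply: (@le_trans _ _ ((L * (k 0 - k t) + 1) * d1)).
    apply: ler_pM; [by rewrite mulr_ge0|exact: ltW|by rewrite lerDl|exact: ltW].
  by rewrite mulrC -ler_pdivlMr// ge_min lexx orbT.
have -> : I - (w 0 * K t - w t * K 0 + J) =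
   - (w 0 * k 0 - w t * k t + S - I) + (S - J).
  by rewrite /k subr0 subrr; ring.
apply: le_trans (ler_normD _ _) _; rewrite normrN.
have := le_trans H1 LhK; move: H2; lra.
Qed.

End riemann_stieltjes.

(** * The service distribution and its survival function *)

Section service.
Context {R : realType} (G g : R -> R).
Local Notation leb := (@lebesgue_measure R).
Local Notation M := (right_end G).
Local Notation h := (hazard G g).
Hypothesis hG : service_distribution G g.

Lemma density_ge0 x : 0 <= x -> 0 <= g x.
Proof. by case: hG => _ + _ _ _; apply. Qed.

Lemma integrable_density : leb.-integrable `[0, +oo[ (EFin \o g).
Proof.
have [mg g0 g1 _ _] := hG; apply/integrableP; split.
  exact/measurable_EFinP.
apply: le_lt_trans (ltry 1); rewrite -g1 le_eqVlt; apply/orP; left; apply/eqP.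
apply: eq_integral => x; rewrite inE/= in_itv/= andbT => x0.
by rewrite ger0_norm// g0.
Qed.

Lemma cdfE x : 0 <= x -> G x = \int[leb]_(y in `[0, x]) g y.
Proof. by have [_ _ _ + _] := hG => /[apply] E; rewrite /Rintegral -E. Qed.

Lemma itv_sub_ge0 (A : set R) : (forall x, A x -> 0 <= x) -> A `<=` `[0, +oo[.
Proof. by move=> H x /H; rewrite /= in_itv/= andbT. Qed.

Lemma cdf0 : G 0 = 0.
Proof. by rewrite cdfE// set_itv1 Rintegral_set1. Qed.

Lemma integrable_densityS (A : set R) : measurable A ->
  (forall x, A x -> 0 <= x) -> leb.-integrable A (EFin \o g).
Proof.
move=> mA A0; apply: integrableS integrable_density => //.
exact: itv_sub_ge0.
Qed.

Lemma integrable_density_itv x (c : bool) :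
  leb.-integrable [set` Interval (BSide c 0) (BRight x)] (EFin \o g).
Proof.
apply: integrable_densityS => // y /=; rewrite in_itv.
by case: c => /= /andP[] // /ltW.
Qed.

Lemma cdf_nondecreasing x y : 0 <= x -> x <= y -> G x <= G y.
Proof.
move=> x0 xy; rewrite !cdfE// ?(le_trans x0)//.
rewrite -subr_ge0 Rintegral_itvB ?bnd_simp//; last exact: integrable_density_itv.
apply: Rintegral_ge0 => z /=; rewrite in_itv/= => /andP[xz _].
by apply: density_ge0; rewrite (le_trans x0)// ltW.
Qed.

Lemma cdf_ge0 x : 0 <= x -> 0 <= G x.
Proof. by move=> x0; rewrite -cdf0 cdf_nondecreasing. Qed.

Lemma cdf_le1 x : 0 <= x -> G x <= 1.
Proof.
have [mg g0 g1 GE _] := hG.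
move=> x0; rewrite -lee_fin GE// -g1; apply: ge0_subset_integral => //.
- exact/measurable_EFinP.
- by move=> y /=; rewrite in_itv/= andbT lee_fin; exact: g0.
- by apply: itv_sub_ge0 => y /=; rewrite in_itv/= => /andP[].
Qed.

(** The integrals of g over [0, n] increase to its total mass. *)
Lemma cdf_cvg1 e : 0 < e -> exists2 x, 0 <= x & 1 - e < G x.
Proof.
move=> e0; have [mg g0 g1 GE _] := hG.
have := @ge0_nondecreasing_set_cvg_integral _ (measurableTypeR R) R
  (fun n : nat => `[0 : R, n%:R]%classic)
  (fun x : R => (g x)%:E) leb.
move=> /(_ _ _ _ _)/wrap[].
- move=> m n mn; apply/subsetPset; apply: subset_itvl.
  by rewrite bnd_simp ler_nat.
- by [].
- move=> n; apply/measurable_EFinP; apply: measurable_funS mg => //.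
  by apply: itv_sub_ge0 => y /=; rewrite in_itv/= => /andP[].
- by move=> n x /=; rewrite in_itv/= => /andP[x0 _]; rewrite lee_fin g0.
have -> : \bigcup_n `[0, n%:R]%classic = `[0, +oo[%classic :> set R.
  apply/seteqP; split => [x [n _]|x] /=; rewrite !in_itv/= andbT; first by case/andP.
  move=> x0; exists (Num.truncn x).+1 => //=; rewrite in_itv/= x0/=.
  by apply: ltW; rewrite truncnS_gt.
rewrite g1.
under eq_fun do rewrite -GE ?ler0n//.
move=> /fine_cvgP[_ /cvgrPdist_lt/(_ _ e0)[N _ /(_ N)]] /= => /(_ (leqnn _)) HN.
exists N%:R => //.
have := ler_norm (1 - G N%:R); lra.
Qed.

(** Extending the density by a constant c on the negative axis serves two purposes:
c = 0 gives continuity of G up to 0, and c = g 0 gives a density that is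
continuous across 0, so that G is differentiable there through a two-sided
argument. *)
Lemma cdf_extension_integrable c a b :
  leb.-integrable `[a, b] (EFin \o (fun y => if y < 0 then c else g y)).
Proof.
rewrite (_ : (fun y => _) = (fun y => c * \1_(`]-oo, 0[ : set R) y + (g \_ `[0, +oo[) y)).
  apply: integrable_add => //.
    apply: integrable_scale => //.
    apply: (@bounded_integrable _ _ R leb _ _ 1) => //.
      exact: lebesgue_itv_lty.
    by move=> x _; rewrite indicE; case: (_ \in _); rewrite ?normr1 ?normr0.
  apply: (@integrableS _ _ R leb setT) => //.
  have -> : EFin \o g \_ `[0, +oo[ = (EFin \o g) \_ `[0, +oo[.
    by rewrite restrict_EFin.
  by apply/(integrable_mkcond _ _).1 => //; exact: integrable_density.
apply/funext => y; rewrite indicE patchE.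
case: (ltP y 0) => y0.
  rewrite mem_set/= ?in_itv//= mulr1 memNset ?addr0//=.
  by rewrite in_itv/= andbT; apply/negP; rewrite -ltNge.
rewrite memNset/=; last by rewrite in_itv/=; apply/negP; rewrite -leNgt.
by rewrite mulr0 add0r mem_set//= in_itv/= y0.
Qed.

Lemma cdf_extensionE c a x : a <= 0 -> a <= x ->
  \int[leb]_(y in `[a, x]) (if y < 0 then c else g y) =
  extend_linear G c x - c * a.
Proof.
have E z : a <= z -> z <= 0 ->
    \int[leb]_(y in `[a, z]) (if y < 0 then c else g y) = c * (z - a).
  move=> az z0.
  rewrite -Rintegral_itv_bndo_bndc; last first.
    apply: integrableS (cdf_extension_integrable c a z) => //.
    exact: subset_itv_co_cc.
  rewrite (@eq_Rintegral _ _ _ leb _ (cst c)) => [|y]; last first.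
    rewrite inE/= in_itv/= => /andP[_ yz].
    by rewrite ifT// (lt_le_trans yz).
  rewrite Rintegral_cst//; have : leb `[a, z[ = (z - a)%:E.
    rewrite lebesgue_measure_itv/= lte_fin.
    by move: az; rewrite le_eqVlt => /predU1P[->|->//]; rewrite ltxx subrr.
  by rewrite [X in X = _ -> _ * fine X = _]/= => ->.
move=> a0 ax; rewrite /extend_linear cdf0; case: (ltP x 0) => [x0|x0].
  by rewrite E// ?ltW//; ring.
have := @Rintegral_itvB R _ (BLeft a) (BRight x) 0 (cdf_extension_integrable c a x).
rewrite !bnd_simp => /(_ a0 x0); rewrite (E 0)// => /eqP; rewrite subr_eq => /eqP ->.
rewrite (@eq_Rintegral _ _ _ leb _ g) => [|y]; last first.
  by rewrite inE/= in_itv/= => /andP[y0 _]; rewrite ltNge ltW.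
rewrite Rintegral_itv_obnd_cbnd; last exact: integrable_density_itv.
by rewrite -cdfE//; ring.
Qed.

Lemma cdf_extension_continuous c : continuous (extend_linear G c).
Proof.
move=> x; pose a := Num.min x 0 - 1; pose b := x + 1.
have [ax a0] : a < x /\ a < 0.
  by rewrite /a; case: (leP x 0) => ?; split; lra.
have xb : x < b by rewrite /b; lra.
have ab : a < b by exact: lt_trans xb.
have := parameterized_integral_continuous (ltW ab)
  (cdf_extension_integrable c a b).
move/(continuous_within_itvP _ ab) => [/(_ x) + _ _].
rewrite in_itv/= ax xb => /(_ isT) cx.
have : {for x, continuous (fun y => parameterized_integral leb a y
    (fun y => if y < 0 then c else g y) + c * a)}.
  by apply: cvgD => //; exact: cvg_cst.
rewrite /prop_for /continuous_at /parameterized_integral cdf_extensionE ?(ltW _)//.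
rewrite subrK; apply: cvg_trans; apply: near_eq_cvg; near=> y.
rewrite cdf_extensionE ?subrK//; first exact: ltW.
by apply: ltW; near: y; exact: lt_nbhsr.
Unshelve. all: by end_near. Qed.

(** Every level below 1 is attained because G is continuous and tends to 1. *)
Lemma cdf_ivt v : 0 <= v < 1 -> exists2 b, 0 <= b & G b = v.
Proof.
move=> /andP[v0 v1].
have [N N0] : exists2 x, 0 <= x & 1 - (1 - v) < G x.
  by apply: cdf_cvg1; rewrite subr_gt0.
rewrite opprB addrC subrK => vN.
have [||c] := @IVT R (extend_linear G 0) 0 N v N0.
- exact/continuous_subspaceT/cdf_extension_continuous.
- rewrite /extend_linear ltxx ltNge N0/= cdf0.
  by rewrite ge_min v0 le_max (ltW vN) orbT.
rewrite in_itv/= => /andP[c0 _].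
by rewrite /extend_linear ltNge c0/= => cv; exists c.
Qed.

Lemma cdf_lt_le x y : 0 <= x -> 0 <= y -> G x < G y -> x < y.
Proof.
by move=> x0 y0; apply: contraTT; rewrite -!leNgt => yx; exact: cdf_nondecreasing.
Qed.

(** The supremum that defines the right end is not attained: if G x < 1, a larger
point at which G is still below 1 exists by continuity. *)
Lemma ages_right_endE x : ages M x <-> 0 <= x /\ G x < 1.
Proof.
split=> -[x0 xM]; split=> //.
  have [_ [y [y0 Gy] <-]] := ereal_sup_gt xM; rewrite lte_fin => xy.
  by apply: le_lt_trans Gy; apply: cdf_nondecreasing => //; exact: ltW.
(* any level strictly between G x and 1 would do *)
have [|y y0 Gy] := @cdf_ivt ((G x + 1) / 2).
  by rewrite divr_ge0 ?addr_ge0 ?cdf_ge0//=; lra.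
have xy : x < y by apply: cdf_lt_le => //; rewrite Gy; lra.
apply: (@lt_le_trans _ _ y%:E); first by rewrite lte_fin.
by apply: ereal_sup_ubound; exists y => //; split=> //; rewrite Gy; lra.
Qed.

(** The survival function 1 - G, extended linearly to negative ages.  Its positivity
characterises the points to the left of the right end, which turns membership
in the age interval into an open condition. *)
Definition survival x : R := 1 - extend_linear G (g 0) x.

Lemma survivalE x : 0 <= x -> survival x = 1 - G x.
Proof. by rewrite /survival /extend_linear ltNge => ->. Qed.

Lemma survival_neg x : x <= 0 -> 1 <= survival x.
Proof.
rewrite le_eqVlt => /predU1P[->|x0]; first by rewrite survivalE// cdf0 subr0.
rewrite /survival /extend_linear x0 cdf0 add0r.
by rewrite lerBrDl gerDr mulr_ge0_le0 ?density_ge0// ltW.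
Qed.

Lemma survival_ge0 x : 0 <= survival x.
Proof.
have [x0|x0] := leP 0 x; first by rewrite survivalE// subr_ge0 cdf_le1.
by rewrite (le_trans _ (survival_neg (ltW x0))).
Qed.

Lemma survival_le1 x : 0 <= x -> survival x <= 1.
Proof. by move=> x0; rewrite survivalE// gerBl cdf_ge0. Qed.

Lemma survival_gt0 x : 0 < survival x <-> ages M (Num.max x 0).
Proof.
rewrite ages_right_endE; case: (leP 0 x) => x0.
  by rewrite survivalE// subr_gt0; split=> [|[]].
rewrite cdf0; split=> // _; exact: lt_le_trans (survival_neg (ltW x0)).
Qed.

Lemma survival_continuous : continuous survival.
Proof. by move=> x; apply: cvgB; [exact: cvg_cst|exact: cdf_extension_continuous]. Qed.

Lemma survival_gt0_near x : 0 < survival x -> \forall y \near x, 0 < survival y.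
Proof. by move=> Ux; exact: (cvgr_gt _ (@survival_continuous x) _ Ux). Qed.

Hypothesis ch : {within ages M, continuous h}.

Definition density_ext x : R := g (Num.max x 0).

(** The continuity assumption bears on the hazard rate only; the continuity of g
on the ages is recovered from this factorisation. *)
Lemma density_extE x : 0 < survival x ->
  density_ext x = h (Num.max x 0) * survival (Num.max x 0).
Proof.
move=> /survival_gt0/ages_right_endE[x0 Gx].
rewrite /density_ext /hazard survivalE// divfK//.
by rewrite subr_eq0 gt_eqF.
Qed.

Lemma density_ext_continuous x : 0 < survival x ->
  {for x, continuous density_ext}.
Proof.
move=> Ux.
have ax := (survival_gt0 x).1 Ux.
suff H : h (Num.max y 0) * survival (Num.max y 0) @[y --> x] --> density_ext x.
  apply: cvg_trans H; apply: near_eq_cvg; near=> y; rewrite density_extE//.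
  by near: y; exact: survival_gt0_near.
rewrite density_extE//; apply: cvgM; last first.
  apply: (@continuous_comp _ _ _ (fun x : R => Num.max x 0) survival).
    exact: continuous_max0.
  exact: survival_continuous.
have /subspace_continuousP/(_ _ ax) hx := ch.
apply: (@cvg_comp _ _ _ (fun y => Num.max y 0) h _ _ _ _ hx) => P /= HP.
have := continuous_max0 HP; rewrite /= => {}HP.
near=> y; have : ages M (Num.max y 0) -> P (Num.max y 0) by near: y.
apply; apply/survival_gt0; near: y; exact: survival_gt0_near.
Unshelve. all: by end_near. Qed.

(** Near x the function is, up to a constant, an integral with variable upper bound
starting strictly to the left of both x and 0; this makes x = 0 an interior
point. *)
Lemma is_derive_survival x : 0 < survival x ->
  is_derive x 1 survival (- density_ext x).
Proof.
move=> Ux; pose a := Num.min x 0 - 1.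
have [ax a0] : a < x /\ a < 0.
  by rewrite /a; case: (leP x 0) => ?; split; lra.
have E : (fun y => if y < 0 then g 0 else g y) = density_ext.
  by apply/funext => y; rewrite /density_ext; case: ltP.
have xx : x < x + 1 by rewrite ltrDl.
have := @continuous_FTC1_closed R _ a x _ xx (cdf_extension_integrable (g 0) a (x + 1)) ax.
rewrite E => /(_ (density_ext_continuous Ux)) [dF F'].
have {F'}dF : is_derive x 1 (fun y => \int[leb]_(t in `[a, y]) density_ext t) (density_ext x).
  by split; [exact: dF|rewrite -derive1E F'; exact: (congr1 (fun f => f x) E)].
pose F y := 1 - g 0 * a - \int[leb]_(t in `[a, y]) density_ext t.
apply: (@near_eq_is_derive _ _ _ F).
  near=> y; rewrite /F /survival -E cdf_extensionE//; last 2 first.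
  - exact: ltW.
  - by apply: ltW; near: y; exact: lt_nbhsr.
  by ring.
rewrite -[- density_ext x]add0r; apply: is_deriveB.
Unshelve. all: by end_near. Qed.

End service.

(** * Smooth cutoffs in time *)

Section cutoffs.
Context {R : realType}.
Implicit Types (F f w v : R -> R) (A : set R) (x y l : R).

Lemma is_derive_shift w x a l :
  is_derive (x + a) 1 w l -> is_derive x 1 (fun y => w (y + a)) l.
Proof.
move=> H; have H2 : is_derive x 1 (fun y => y + a) 1.
  rewrite (_ : (fun y => y + a) = (fun y => a + 1 * y)).
    exact: is_derive_linear.
  by apply/funext => y; rewrite mul1r addrC.
by have := @is_derive1_comp _ w (fun y => y + a) x l 1 H H2; rewrite mulr1.
Qed.

Lemma is_derive_reflect w x a l :
  is_derive (a - x) 1 w l -> is_derive x 1 (fun y => w (a - y)) (- l).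
Proof.
move=> H; have H2 : is_derive x 1 (fun y => a - y) (-1).
  rewrite (_ : (fun y => a - y) = (fun y => a + (-1) * y)).
    exact: is_derive_linear.
  by apply/funext => y; rewrite mulN1r.
by have := @is_derive1_comp _ w (fun y => a - y) x l (-1) H H2; rewrite mulrN1.
Qed.

Lemma is_derive_mul F f x l m : is_derive x 1 F l -> is_derive x 1 f m ->
  is_derive x 1 (fun y => F y * f y) (l * f x + F x * m).
Proof.
move=> H1 H2; have := is_deriveM H1 H2.
by rewrite /GRing.scale/= addrC (mulrC l).
Qed.

Lemma is_derive_div F f x l m : f x != 0 ->
  is_derive x 1 F l -> is_derive x 1 f m ->
  is_derive x 1 (fun y => F y / f y) (l / f x - F x * m / f x ^+ 2).
Proof.
move=> fx H1 H2.
have := is_derive_mul H1 (is_deriveV fx H2).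
by rewrite /GRing.scale/= mulNr mulrN -exprVn expr2 (mulrC _ m) mulrA.
Qed.

Lemma is_derive_cst_mul (a : R) F x l : is_derive x 1 F l ->
  is_derive x 1 (fun y => a * F y) (a * l).
Proof. by move=> H; exact: is_deriveZ. Qed.

Lemma sqr_pos0 x : x <= 0 -> sqr_pos x = 0.
Proof. by move=> x0; rewrite /sqr_pos max_r// expr0n. Qed.

Lemma sqr_posE x : 0 <= x -> sqr_pos x = x ^+ 2.
Proof. by move=> x0; rewrite /sqr_pos max_l. Qed.

(** A C^1 function of s equal to 1 up to time t and to 0 from time t + eta on. *)
Definition cutoff (t eta s : R) : R := sqr_pos (1 - sqr_pos ((s - t) / eta)).

Definition cutoff' (t eta s : R) : R :=
  2 * Num.max (1 - sqr_pos ((s - t) / eta)) 0 *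
  (- (2 * Num.max ((s - t) / eta) 0 * eta^-1)).

Lemma is_derive_cutoff (t eta s : R) : is_derive s 1 (cutoff t eta) (cutoff' t eta s).
Proof.
apply: (@is_derive1_comp _ sqr_pos (fun s => 1 - sqr_pos ((s - t) / eta))).
  exact: is_derive_sqr_pos.
rewrite -[X in is_derive _ _ _ X]add0r; apply: is_deriveB.
apply: (@is_derive1_comp _ sqr_pos (fun s => (s - t) / eta)).
  exact: is_derive_sqr_pos.
rewrite (_ : (fun _ => _) = (fun s => - (t / eta) + eta^-1 * s)).
  exact: is_derive_linear.
by apply/funext => y; ring.
Qed.

Lemma cutoff'_continuous (t eta : R) : continuous (cutoff' t eta).
Proof.
have c1 : continuous (fun s : R => (s - t) / eta).
  by move=> s; apply: cvgMl; apply: cvgB; [exact: cvg_id|exact: cvg_cst].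
have c2 : continuous (@sqr_pos R).
  by apply: is_derive_continuous; exact: is_derive_sqr_pos.
move=> s; apply: cvgM.
  apply: cvgMr.
  apply: (@continuous_comp _ _ _ (fun s => 1 - sqr_pos ((s - t) / eta))
     (fun x => Num.max x 0)); last exact: continuous_max0.
  apply: cvgB; first exact: cvg_cst.
  by apply: (@continuous_comp _ _ _ (fun s => (s - t) / eta) sqr_pos);
    [exact: c1|exact: c2].
apply: cvgN; apply: cvgMl; apply: cvgMr.
apply: (@continuous_comp _ _ _ (fun s => (s - t) / eta) (fun x => Num.max x 0)).
  exact: c1.
exact: continuous_max0.
Qed.

Lemma cutoff_before (t eta s : R) : 0 < eta -> s <= t -> cutoff t eta s = 1.
Proof.
move=> e0 st; rewrite /cutoff (@sqr_pos0 ((s - t) / eta)) ?subr0.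
  by rewrite sqr_posE// expr1n.
by rewrite pmulr_lle0 ?invr_gt0// subr_le0.
Qed.

Lemma cutoff'_before (t eta s : R) : 0 < eta -> s <= t -> cutoff' t eta s = 0.
Proof.
move=> e0 st; rewrite /cutoff' (max_r (_ : (s - t) / eta <= 0)).
  by rewrite mulr0 mul0r oppr0 mulr0.
by rewrite pmulr_lle0 ?invr_gt0// subr_le0.
Qed.

Lemma cutoff_after (t eta s : R) : 0 < eta -> t + eta <= s -> cutoff t eta s = 0.
Proof.
move=> e0 st; rewrite /cutoff sqr_pos0// subr_le0 sqr_posE.
  by rewrite exprn_ege1// ler_pdivlMr// mul1r; lra.
by rewrite divr_ge0 ?ltW//; lra.
Qed.

End cutoffs.

(** * Test functions transported along characteristics *)

Section test.
Context {R : realType} (G g : R -> R).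
Local Notation leb := (@lebesgue_measure R).
Local Notation M := (right_end G).
Local Notation h := (hazard G g).
Hypothesis hG : service_distribution G g.
Hypothesis ch : {within ages M, continuous h}.
Local Notation U := (survival G g).
Local Notation dens := (density_ext g).

Lemma ages_survival_gt0 x : ages M x -> 0 < U x.
Proof.
move=> ax; apply/(survival_gt0 hG); rewrite max_l//.
by case: ax.
Qed.

Lemma ages_hazardE x : ages M x -> h x = dens x / U x.
Proof.
by move=> [x0 _]; rewrite /hazard survivalE// /density_ext max_l.
Qed.

Lemma ages_le x y : 0 <= x -> x <= y -> ages M y -> ages M x.
Proof.
by move=> x0 xy [y0 yM]; split=> //; apply: le_lt_trans yM; rewrite lee_fin.
Qed.

Section phi.
Variables (w v : R -> R) (t b c : R).
Hypothesis t0 : 0 <= t.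
Hypothesis dw : forall x : R, is_derive x 1 w (v x).
Hypothesis cv : continuous v.
Hypothesis w0 : forall x, b <= x -> w x = 0.
Hypothesis bc : b < c.
Hypothesis ac : ages M c.

Local Notation chi := (cutoff t (c - b)).
Local Notation chi' := (cutoff' t (c - b)).

Let phi x s := chi s * (w (x + t - s) / U x).
Let phix x s := chi s * (v (x + t - s) / U x + w (x + t - s) * dens x / U x ^+ 2).
Let phis x s := chi' s * (w (x + t - s) / U x) + chi s * (- (v (x + t - s)) / U x).

(** The profile w(x + t - s) is constant along the characteristics x - s = const.
As w vanishes beyond b < c, the time cutoff of width c - b confines the support
to ages at most c, which stays away from the right end. *)
Lemma transported_test_function : test_function M phi phix phis.
Proof.
have cw : continuous w := is_derive_continuous dw.
have e0 : 0 < c - b by rewrite subr_gt0.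
have csub (f : R -> R) : continuous f ->
    continuous (fun z : R * R => f (z.1 + t - z.2)).
  move=> cf z; apply: (@continuous_comp _ _ _ (fun z : R * R => z.1 + t - z.2) f).
    apply: cvgB; last exact: cvg_snd.
    by apply: cvgD; [exact: cvg_fst|exact: cvg_cst].
  exact: cf.
have c2 (f : R -> R) : continuous f -> continuous (fun z : R * R => f z.2).
  by move=> cf z; apply: (@continuous_comp _ _ _ snd f); [exact: cvg_snd|exact: cf].
have c1 (f : R -> R) (z : R * R) : {for z.1, continuous f} -> {for z, continuous (fun z => f z.1)}.
  by move=> cf; apply: (@continuous_comp _ _ _ fst f); [exact: cvg_fst|exact: cf].
have cU := survival_continuous hG.
have cUV (z : R * R) : age_time M z -> {for z, continuous (fun z => (U z.1)^-1)}.
  move=> [az _]; apply: cvgV; first by rewrite gt_eqF// ages_survival_gt0.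
  by apply: c1; exact: cU.
have cchi : continuous chi := is_derive_continuous (is_derive_cutoff _ _).
have cchi' := @cutoff'_continuous R t (c - b).
have dchi := @is_derive_cutoff R t (c - b).
split.
- move=> x s [/= ax s0]; apply: is_derive_within.
  have Ux := ages_survival_gt0 ax.
  apply: is_derive_cst_mul.
  have -> : v (x + t - s) / U x + w (x + t - s) * dens x / U x ^+ 2 =
     v (x + t - s) / U x - w (x + t - s) * (- dens x) / U x ^+ 2.
    by rewrite mulrN mulNr opprK.
  apply: is_derive_div; first by rewrite gt_eqF.
    rewrite (_ : (fun y => w (y + t - s)) = (fun y => w (y + (t - s)))).
      by apply: is_derive_shift; rewrite addrA.
    by apply/funext => y; rewrite addrA.
  exact: is_derive_survival.
- move=> x s [/= ax s0]; apply: is_derive_within.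
  apply: is_derive_mul => //.
  rewrite [X in is_derive _ _ _ X]mulrC.
  rewrite (_ : (fun y => _) = (fun y => (U x)^-1 * w (x + t - y))).
    by apply: is_derive_cst_mul; exact: is_derive_reflect.
  by apply/funext => y; rewrite mulrC.
- apply: continuous_in_subspaceT => z; rewrite inE => az.
  have Uz : 0 < U z.1 by case: az => + _; exact: ages_survival_gt0.
  apply: cvgM; first exact: c2.
  apply: cvgD; first by apply: cvgM; [exact: (csub v cv z)|exact: cUV].
  apply: cvgM; first apply: cvgM; first exact: (csub w cw z).
    exact: (c1 dens z (density_ext_continuous hG ch Uz)).
  rewrite (_ : (fun z : R * R => (U z.1 ^+ 2)^-1) = (fun z => (U z.1)^-1 * (U z.1)^-1)).
    by rewrite -exprVn expr2; apply: cvgM; exact: cUV.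
  by apply/funext => y; rewrite -exprVn expr2.
- apply: continuous_in_subspaceT => z; rewrite inE => az.
  apply: cvgD.
    apply: cvgM; first exact: c2.
    by apply: cvgM; [exact: (csub w cw z)|exact: cUV].
  apply: cvgM; first exact: c2.
  by apply: cvgM; [apply: cvgN; exact: (csub v cv z)|exact: cUV].
- exists (`[0, c] `*` `[0, t + (c - b)]); split.
  + by apply: compact_setX; exact: segment_compact.
  + move=> [x s] [/=]; rewrite !in_itv/= => /andP[x0 xc] /andP[s0 _].
    by split => //=; exact: ages_le xc ac.
  + move=> x s [/= ax s0]; rewrite !in_itv/= => nC.
    have [x0 _] := ax.
    rewrite /phi; have [st|st] := leP (t + (c - b)) s.
      by rewrite cutoff_after// mul0r.
    rewrite w0 ?mul0r ?mulr0//.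
    have [xc|xc] := leP x c; last by lra.
    by exfalso; apply: nC; rewrite x0 xc s0 ltW.
Qed.

(** Division by the survival function compensates exactly the loss of mass at rate h
along a characteristic. *)
Lemma transported_cancel x s : ages M x -> s <= t ->
  phis x s + phix x s = h x * phi x s.
Proof.
move=> ax st; have e0 : 0 < c - b by rewrite subr_gt0.
have Ux := ages_survival_gt0 ax.
rewrite /phis /phix /phi cutoff'_before// cutoff_before// ages_hazardE//.
by field; rewrite gt_eqF.
Qed.

Lemma survival0 : U 0 = 1.
Proof. by rewrite survivalE// (cdf0 hG) subr0. Qed.

(** Up to time t the drift terms of the fluid equation cancel for the transported
test function; the integral against the entry process is then integrated by
parts. *)
Lemma fluid_transport E X nu : fluid_solution M h E X nu ->
  {in `[0, +oo[ &, {homo entry M h nu : x y / x <= y}} ->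
  pairing M (fun x => w x / U x) (nu t) =
    pairing M (fun x => w (x + t) / U x) (nu 0)
    + w 0 * entry M h nu t - w t * entry M h nu 0
    + \int[leb]_(s in `[0, t]) (entry M h nu (t - s) * v s).
Proof.
move=> [_ _ _ tests _] hK.
have e0 : 0 < c - b by rewrite subr_gt0.
have [I HI] := tests _ _ _ transported_test_function _ t0.
have -> : \int[leb]_(s in `[0, t]) pairing M (fun x => phis x s + phix x s) (nu s) =
    \int[leb]_(s in `[0, t]) pairing M (fun x => h x * phi x s) (nu s).
  apply: eq_Rintegral => s; rewrite inE/= in_itv/= => /andP[s0 st].
  apply: eq_Rintegral => x; rewrite inE => ax.
  exact: transported_cancel.
rewrite addrK.
have -> : pairing M (fun x => phi x t) (nu t) = pairing M (fun x => w x / U x) (nu t).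
  apply: eq_Rintegral => x _.
  by rewrite /phi cutoff_before// mul1r addrK.
have -> : pairing M (fun x => phi x 0) (nu 0) = pairing M (fun x => w (x + t) / U x) (nu 0).
  apply: eq_Rintegral => x _.
  by rewrite /phi cutoff_before// mul1r subr0.
move=> ->.
(* monotonicity is known on the half line only, hence the extension by K 0 *)
pose K s := entry M h nu (Num.max s 0).
have K_homo : {homo K : x y / x <= y}.
  move=> x y xy; apply: hK; last by rewrite ge_max !le_max xy lexx orbT.
    by rewrite in_itv/= le_max lexx orbT.
  by rewrite in_itv/= le_max lexx orbT.
have aw s : 0 <= s <= t -> phi 0 s = w (t - s).
  move=> /andP[s0 st].
  by rewrite /phi cutoff_before// mul1r add0r survival0 divr1.
have KI : is_RS_integral (fun s => phi 0 s) K 0 t I.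
  move=> e e1; have [d d0 Hd] := HI _ e1; exists d => // s xi sP p xiP.
  have := Hd s xi sP xiP.
  rewrite (_ : \sum_(0 <= i < size s) _ =
    \sum_(0 <= i < size s) phi 0 (xi i) * (K (p i.+1) - K (p i)))//.
  rewrite big_nat_cond [RHS]big_nat_cond; apply: eq_bigr => i.
  rewrite andbT => /andP[_ iN].
  rewrite /K !max_l//; apply: itv_partition_nth_ge sP => //.
  exact: ltnW.
rewrite (RS_integral_by_parts t0 K_homo dw cv aw KI).
rewrite /K (max_l t0) max_l// !addrA; congr (_ + _).
apply: eq_Rintegral => s; rewrite inE/= in_itv/= => /andP[s0 st].
by rewrite max_l// subr_ge0.
Qed.

End phi.
End test.

(** * Removing the truncation near the right end *)

Section dominated.
Context d (T : measurableType d) (R : realType) (mu : {measure set T -> \bar R}).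

Lemma Rintegral_dominated_cvg (D : set T) (F : nat -> T -> R) (f k : T -> R) :
  measurable D -> (forall n, measurable_fun D (F n)) ->
  (forall x, D x -> F n x @[n --> \oo] --> f x) ->
  mu.-integrable D (EFin \o k) -> (forall n x, D x -> `|F n x| <= k x) ->
  mu.-integrable D (EFin \o f) /\
  \int[mu]_(x in D) F n x @[n --> \oo] --> \int[mu]_(x in D) f x.
Proof.
move=> mD mF Ff ik Fk.
have mf : measurable_fun D f by exact: measurable_fun_cvg mF Ff.
have [|||||i_f _ H] := @dominated_convergence _ _ _ mu D mD (fun n => EFin \o F n)
  (EFin \o f) (EFin \o k).
- by move=> n; apply/measurable_EFinP.
- exact/measurable_EFinP.
- by apply: aeW => x Dx; apply: cvg_EFin; [exact: nearW|exact: Ff].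
- by [].
- by apply: aeW => x n Dx /=; rewrite lee_fin Fk.
split=> //; apply: fine_cvg; rewrite fineK//.
exact: integrable_fin_num.
Qed.

End dominated.

Section limit.
Context {R : realType} (G g : R -> R).
Local Notation leb := (@lebesgue_measure R).
Local Notation M := (right_end G).
Local Notation h := (hazard G g).
Hypothesis hG : service_distribution G g.
Hypothesis ch : {within ages M, continuous h}.
Local Notation U := (survival G g).
Local Notation dens := (density_ext g).

Lemma measurable_ages : measurable (ages M).
Proof.
apply: is_interval_measurable => x y [x0 _] [_ yM] z /andP[xz zy].
by split; [exact: le_trans xz|apply: le_lt_trans yM; rewrite lee_fin].
Qed.

Section trunc.
Variables (f f' : R -> R).
Hypothesis hf : C1_bounded f f'.

Let F := extend_linear f (f' 0).
Let F' x := f' (Num.max x 0).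

Let dF (x : R) : is_derive x 1 F (F' x).
Proof. by case: hf => H _ _ _; exact: is_derive_extend_linear. Qed.

Let cF' : continuous F'.
Proof.
case: hf => _ /subspace_continuousP H _ _ x.
have {}H := H (Num.max x 0).
have m0 (y : R) : `[0, +oo[%classic (Num.max y 0).
  by rewrite /= in_itv/= andbT le_max lexx orbT.
have {}H := H (m0 x).
apply: (@cvg_comp _ _ _ (fun y => Num.max y 0) f' _ _ _ _ H) => P /= HP.
have {}HP : \forall y \near x, `[0, +oo[%classic (Num.max y 0) -> P (Num.max y 0).
  exact: (continuous_max0 HP).
by apply: filterS HP => y; apply.
Qed.

(** The truncation multiplies f by the square of this ratio, once divided by the
survival function; it lies in [0, 1] and tends to 1 on the ages. *)
Definition ratio e x : R := Num.max (U x - e) 0 / U x.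

Lemma ratio_itv e x : 0 <= e -> 0 <= ratio e x <= 1.
Proof.
move=> e0; have := survival_ge0 hG x; rewrite le_eqVlt => /predU1P[U0|U0].
  by rewrite /ratio -U0 invr0 mulr0 lexx ler01.
rewrite /ratio divr_ge0 ?(ltW U0) ?le_max ?lexx ?orbT//=.
by rewrite ler_pdivrMr// mul1r ge_max (ltW U0) andbT gerBl.
Qed.

(** The C^1 replacement of f (1 - G) that vanishes where 1 - G <= e.  The square of the
positive part makes it C^1 at the edge, and dividing it by 1 - G keeps the
derivative bounded by |f'| + |f| g uniformly in e. *)
Definition trunc e x : R := F x * (sqr_pos (U x - e) / U x).
Definition trunc' e x : R :=
  F' x * (sqr_pos (U x - e) / U x) - F x * dens x * (2 * ratio e x - ratio e x ^+ 2).

(** Beyond the right end the survival function is 0; there the convention that the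
inverse of 0 is 0 is harmless, as the numerators vanish as well. *)
Lemma trunc_vanish e x : 0 < e -> U x <= e -> trunc e x = 0 /\ trunc' e x = 0.
Proof.
move=> e0 Ue; have Ue' : U x - e <= 0 by rewrite subr_le0.
rewrite /trunc /trunc' /ratio sqr_pos0// max_r// !mul0r expr0n !mulr0.
by rewrite subrr mulr0 subrr.
Qed.

Lemma is_derive_trunc (e x : R) : 0 < e -> is_derive x 1 (trunc e) (trunc' e x).
Proof.
move=> e0; have [Ue|Ue] := ltP (U x) e.
  have [_ ->] := trunc_vanish e0 (ltW Ue).
  apply: (@near_eq_is_derive _ _ _ (cst 0)).
  near=> y; rewrite (trunc_vanish e0 _).1//; apply: ltW; near: y.
  exact: (cvgr_lt _ (@survival_continuous _ _ _ hG x) _ Ue).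
have U0 : 0 < U x by exact: lt_le_trans Ue.
have dU := is_derive_survival hG ch U0.
have dq : is_derive x 1 (fun y => sqr_pos (U y - e)) (2 * Num.max (U x - e) 0 * (- dens x)).
  apply: (@is_derive1_comp _ (@sqr_pos R) (fun y => U y - e)).
    exact: is_derive_sqr_pos.
  by rewrite -[- dens x]subr0; apply: is_deriveB.
have U0' : U x != 0 by rewrite gt_eqF.
have := is_derive_mul (dF x) (is_derive_div U0' dq dU).
congr (is_derive _ _ _ _); rewrite /trunc' /ratio /sqr_pos.
by field.
Unshelve. all: by end_near. Qed.

(** Every point either has survival function below e, where everything vanishes
locally, or lies strictly to the left of the right end, where the density is
continuous. *)
Lemma trunc'_continuous e : 0 < e -> continuous (trunc' e).
Proof.
move=> e0 x; have [Ue|Ue] := ltP (U x) e.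
  rewrite /prop_for /continuous_at (trunc_vanish e0 (ltW Ue)).2.
  apply: cvg_near_cst; near=> y; rewrite (trunc_vanish e0 _).2//; apply: ltW; near: y.
  exact: (cvgr_lt _ (@survival_continuous _ _ _ hG x) _ Ue).
have U0 : 0 < U x by exact: lt_le_trans Ue.
have cU := @survival_continuous _ _ _ hG x.
have cUV : (U y)^-1 @[y --> x] --> (U x)^-1.
  by apply: cvgV => //; rewrite gt_eqF.
have cUe : U y - e @[y --> x] --> U x - e by apply: cvgB => //; exact: cvg_cst.
have cr : ratio e y @[y --> x] --> ratio e x.
  apply: cvgM => //.
  exact: (continuous_comp cUe (@continuous_max0 _ _)).
have cF : continuous F := is_derive_continuous dF.
apply: cvgB.
  apply: cvgM; first exact: cF'.
  apply: cvgM => //.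
  apply: (continuous_comp cUe).
  exact: (is_derive_continuous (@is_derive_sqr_pos R)).
apply: cvgM.
  by apply: cvgM; [exact: cF|exact: (density_ext_continuous hG ch U0)].
apply: cvgB; first exact: cvgMr.
by rewrite expr2; apply: cvgM.
Unshelve. all: by end_near. Qed.

Lemma sqr_pos_survival e x : sqr_pos (U x - e) / U x = U x * ratio e x ^+ 2.
Proof.
have := survival_ge0 hG x; rewrite le_eqVlt => /predU1P[U0|U0].
  by rewrite -U0 invr0 mulr0 mul0r.
by rewrite /sqr_pos /ratio; field; rewrite gt_eqF.
Qed.

Let e_ (n : nat) : R := n.+2%:R^-1.

Let e_gt0 n : 0 < e_ n.
Proof. by rewrite invr_gt0. Qed.

Let e_cvg : e_ n @[n --> \oo] --> 0.
Proof.
have := @cvg_harmonic R; rewrite -(cvg_shiftS (@harmonic R)).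
exact.
Qed.

Lemma ratio_cvg x : 0 < U x -> ratio (e_ n) x @[n --> \oo] --> (1 : R).
Proof.
move=> U0.
have -> : (1 : R) = Num.max (U x - 0) 0 / U x by rewrite subr0 max_l ?ltW// divff// gt_eqF.
apply: cvgMl.
have H : U x - e_ n @[n --> \oo] --> U x - 0.
  by apply: cvgB; [exact: cvg_cst|exact: e_cvg].
by apply: (@cvg_comp _ _ _ (fun n => U x - e_ n) (fun y => Num.max y 0) _ _ _ H); exact: continuous_max0.
Qed.

(** The derivative of f (1 - G).  The product h (1 - G) stands for g because it equals g
on the ages and vanishes beyond the right end, where g is only known to be 0
almost everywhere. *)
Definition age_kernel s : R := f' s * (1 - G s) - f s * (h s * (1 - G s)).

Lemma bounded_on (k : R -> R) : [bounded k x | x in `[0, +oo[] ->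
  exists2 C, 0 <= C & forall x, 0 <= x -> `|k x| <= C.
Proof.
move=> [C [_ HC]]; exists (`|C| + 1); first by rewrite addr_ge0.
move=> x x0; apply: HC; first by rewrite (le_lt_trans (ler_norm C))// ltrDl.
by rewrite /= in_itv/= andbT.
Qed.

Lemma trunc_survivalE e x : 0 <= x -> trunc e x / U x = f x * ratio e x ^+ 2.
Proof.
move=> x0; rewrite /trunc sqr_pos_survival /F /extend_linear ltNge x0/=.
have := survival_ge0 hG x; rewrite le_eqVlt => /predU1P[U0|U0].
  by rewrite /ratio -U0 invr0 !mulr0 expr0n mulr0.
by field; rewrite gt_eqF.
Qed.

Lemma ratio_sqr_itv e x : 0 <= e -> `|ratio e x ^+ 2| <= 1.
Proof.
move=> e0; have /andP[r0 r1] := ratio_itv x e0.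
by rewrite normrX ger0_norm// exprn_ile1.
Qed.

Lemma trunc_pairing_cvg (mu : subprobability (measurableTypeR R) R) :
  pairing M (fun x => trunc (e_ n) x / U x) mu @[n --> \oo] --> pairing M f mu.
Proof.
have [_ _ /bounded_on[C C0 HC] _] := hf.
have muA : (mu (ages M) < +oo)%E.
  by rewrite -ge0_fin_numE// fin_num_measure//; exact: measurable_ages.
apply: (proj2 (@Rintegral_dominated_cvg _ _ _ mu (ages M) _ f (cst C) _ _ _ _ _)).
- exact: measurable_ages.
- move=> n; apply: subspace_continuous_measurable_fun; first exact: measurable_ages.
  apply: continuous_in_subspaceT => x; rewrite inE => /(ages_survival_gt0 hG) U0.
  apply: cvgM; first exact: (is_derive_continuous (fun x => is_derive_trunc x (e_gt0 n))).
  by apply: cvgV; [rewrite gt_eqF|exact: survival_continuous].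
- move=> x ax; have [x0 _] := ax.
  rewrite -[X in _ --> X]mulr1 -(expr1n _ 2).
  under eq_fun do rewrite trunc_survivalE//.
  apply: cvgMr; rewrite !expr2.
  have H : ratio (e_ n) x @[n --> \oo] --> (1 : R).
    exact: (ratio_cvg (ages_survival_gt0 hG ax)).
  by under eq_fun do rewrite expr2; apply: cvgM.
- apply: (@bounded_integrable _ _ R mu _ _ C) => //; first exact: measurable_ages.
  by move=> x _; rewrite /= ger0_norm.
- move=> n x [x0 _]; rewrite trunc_survivalE// normrM -[X in _ <= X]mulr1.
  by apply: ler_pM => //; [exact: HC|apply: ratio_sqr_itv; exact: ltW].
Qed.

(** This bound does not depend on e and is integrable over bounded intervals, as
required for dominated convergence. *)
Lemma trunc'_bound e x C C' : 0 < e -> 0 <= x -> `|f x| <= C -> `|f' x| <= C' ->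
  `|trunc' e x| <= C' + C * g x.
Proof.
move=> e0 x0 HC HC'.
have /andP[r0 r1] := ratio_itv x (ltW e0).
have gx := density_ge0 hG x0.
rewrite /trunc' /F /F' /extend_linear ltNge x0/= sqr_pos_survival.
rewrite /density_ext max_l//.
apply: (le_trans (ler_normB _ _)); apply: lerD.
  rewrite normrM -[X in _ <= X]mulr1; apply: ler_pM => //.
  rewrite normrM -[X in _ <= X]mulr1; apply: ler_pM => //.
    by rewrite ger0_norm ?(survival_ge0 hG)// survival_le1.
  by apply: ratio_sqr_itv; exact: ltW.
rewrite normrM -[X in _ <= X]mulr1; apply: ler_pM => //.
  by rewrite normrM (ger0_norm gx) ler_wpM2r.
by rewrite ger0_norm; nra.
Qed.

Lemma trunc'_cvg x : 0 <= x -> trunc' (e_ n) x @[n --> \oo] --> age_kernel x.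
Proof.
move=> x0; have := survival_ge0 hG x; rewrite le_eqVlt => /predU1P[U0|U0].
  rewrite /age_kernel -(@survivalE _ G g)// -U0 !mulr0 subrr.
  apply: cvg_near_cst; apply: nearW => n; rewrite (trunc_vanish (e_gt0 n) _).2//.
  by rewrite -U0 ltW.
have ax : ages M x by have := (survival_gt0 hG x).1 U0; rewrite max_l.
have -> : age_kernel x = f' x * (U x * 1 ^+ 2) - f x * g x * (2 * 1 - 1 ^+ 2).
  rewrite /age_kernel -(@survivalE _ G g)// (ages_hazardE _ ax) /density_ext max_l//.
  by field; rewrite gt_eqF.
have H := ratio_cvg U0.
have H2 : ratio (e_ n) x ^+ 2 @[n --> \oo] --> (1 ^+ 2 : R).
  by rewrite expr2; under eq_fun do rewrite expr2; apply: cvgM.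
under eq_fun do rewrite /trunc' /F /F' /density_ext /extend_linear max_l// ltNge x0/= sqr_pos_survival.
apply: cvgB; first by apply: cvgMr; exact: cvgMr.
apply: cvgMr; apply: cvgB => //; exact: cvgMr.
Qed.

Lemma kernel_integral_cvg (K : R -> R) t : 0 <= t ->
  {homo K : x y / x <= y} ->
  leb.-integrable `[0, t] (EFin \o (fun s => K (t - s) * age_kernel s)) /\
  \int[leb]_(s in `[0, t]) (K (t - s) * trunc' (e_ n) s) @[n --> \oo] -->
  \int[leb]_(s in `[0, t]) (K (t - s) * age_kernel s).
Proof.
move=> t0 hK; have [_ _ /bounded_on[C C0 HC] /bounded_on[C' C'0 HC']] := hf.
pose B := `|K 0| + `|K t|.
have hK' : {homo (fun s => K (t - s)) : x y / x <= y >-> y <= x}.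
  by move=> x y xy; apply: hK; rewrite lerD2l lerN2.
apply: (@Rintegral_dominated_cvg _ _ _ leb _ _ _ (fun s => B * (C' + C * g s))).
- by [].
- move=> n; apply: measurable_funM.
    exact: measurable_realfun.nonincreasing_measurable.
  apply: subspace_continuous_measurable_fun => //.
  by apply: continuous_subspaceT; exact: trunc'_continuous.
- move=> x /=; rewrite in_itv/= => /andP[x0 _].
  by apply: cvgMr; exact: trunc'_cvg.
- apply: integrable_scale => //; apply: integrable_add => //.
    apply: (@bounded_integrable _ _ R leb _ _ `|C'|) => //.
    exact: lebesgue_itv_lty.
  by apply: integrable_scale => //; exact: (@integrable_density_itv _ _ _ hG).
- move=> n x /=; rewrite in_itv/= => /andP[x0 xt].
  rewrite normrM; apply: ler_pM => //; last exact: trunc'_bound (HC _ x0) (HC' _ x0).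
  have h1 : K 0 <= K (t - x) by apply: hK; rewrite subr_ge0.
  have h2 : K (t - x) <= K t by apply: hK; rewrite gerBl.
  have := ler_norm (K t); have := ler_norm (- K 0); rewrite normrN => h3 h4.
  have := normr_ge0 (K t); have := normr_ge0 (K 0) => h5 h6.
  by rewrite /B ler_norml; apply/andP; split; lra.
Qed.

(** The limit of the terms that carry the initial measure is identified through the
other terms of the transport formula, each of which converges by dominated
convergence.  The initial terms themselves are left alone: they are the same
for two solutions with a common initial measure. *)
Lemma fluid_trunc_limit E X nu t : 0 <= t -> fluid_solution M h E X nu ->
  {in `[0, +oo[ &, {homo entry M h nu : x y / x <= y}} ->
  entry M h nu 0 = 0 ->
  leb.-integrable `[0, t] (EFin \o (fun s => entry M h nu (t - s) * age_kernel s)) /\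
  pairing M (fun x => trunc (e_ n) (x + t) / U x) (nu 0) @[n --> \oo] -->
    pairing M f (nu t) - f 0 * entry M h nu t
    - \int[leb]_(s in `[0, t]) (entry M h nu (t - s) * age_kernel s).
Proof.
move=> t0 sol hK K0.
pose K s := entry M h nu (Num.max s 0).
have K_homo : {homo K : x y / x <= y}.
  move=> x y xy; apply: hK; last by rewrite ge_max !le_max xy lexx orbT.
    by rewrite in_itv/= le_max lexx orbT.
  by rewrite in_itv/= le_max lexx orbT.
have KE k : {in `[0, t]%classic, (fun s => K (t - s) * k s) =1 (fun s => entry M h nu (t - s) * k s)}.
  by move=> s; rewrite inE/= in_itv/= => /andP[s0 st]; rewrite /K max_l// subr_ge0.
have KI k : \int[leb]_(s in `[0, t]) (K (t - s) * k s) =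
    \int[leb]_(s in `[0, t]) (entry M h nu (t - s) * k s).
  by apply: eq_Rintegral => s; exact: KE.
have [iK Kcvg] := kernel_integral_cvg t0 K_homo.
split.
  apply: eq_integrable iK => // s sI; congr EFin; exact: (KE age_kernel).
rewrite -KI.
have E_ n : pairing M (fun x => trunc (e_ n) (x + t) / U x) (nu 0) =
   pairing M (fun x => trunc (e_ n) x / U x) (nu t) - trunc (e_ n) 0 * entry M h nu t
   - \int[leb]_(s in `[0, t]) (K (t - s) * trunc' (e_ n) s).
  have en1 : e_ n < 1 by rewrite invf_lt1// ltr1n.
  have en0 := e_gt0 n.
  (* the truncated profile vanishes beyond b; the level of c is halfway between
     that of b and 1, which leaves room for the time cutoff *)
  have [|b b0 Gb] := @cdf_ivt _ _ _ hG (1 - e_ n).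
    by rewrite subr_ge0 (ltW en1) gtrBl.
  have [|c c0 Gc] := @cdf_ivt _ _ _ hG (1 - e_ n / 2); first by apply/andP; split; lra.
  have bc : b < c by apply: (cdf_lt_le hG) => //; rewrite Gb Gc; lra.
  have ac : ages M c by apply/(ages_right_endE hG); split=> //; rewrite Gc; lra.
  have w0 x : b <= x -> trunc (e_ n) x = 0.
    move=> bx; apply: (trunc_vanish en0 _).1.
    have x0 := le_trans b0 bx.
    by rewrite survivalE//; have := cdf_nondecreasing hG b0 bx; rewrite Gb; lra.
  have := fluid_transport hG ch t0 (fun x => is_derive_trunc x en0)
    (trunc'_continuous en0) w0 bc ac sol hK.
  rewrite K0 mulr0 subr0 => ->.
  by rewrite KI; ring.
under eq_fun do rewrite E_.
apply: cvgB => //; apply: cvgB; first exact: trunc_pairing_cvg.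
apply: cvgMl.
have U0 : U 0 = 1 by rewrite survivalE// (cdf0 hG) subr0.
have := ratio_cvg (_ : 0 < U 0); rewrite U0 => /(_ ltr01) H.
have H2 : ratio (e_ n) 0 ^+ 2 @[n --> \oo] --> (1 ^+ 2 : R).
  by rewrite expr2; under eq_fun do rewrite expr2; apply: cvgM.
rewrite -[X in _ --> X]mulr1 -(expr1n _ 2).
have E0 n : trunc (e_ n) 0 = f 0 * ratio (e_ n) 0 ^+ 2.
  by rewrite -trunc_survivalE// U0 divr1.
under eq_fun do rewrite E0.
exact: cvgMr.
Qed.

End trunc.
End limit.

(** * A renewal inequality *)

Section monotone_integral.
Context d (T : measurableType d) (R : realType) (mu : {measure set T -> \bar R}).
Local Open Scope ereal_scope.

Import HBNNSimple.

(** The integral of a nonnegative function is a supremum over simple functions, so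
its monotonicity in the domain needs no measurability.  This matters for the
rate of departures, whose measurability in time is not known. *)
Lemma ge0_integral_monotone_domain (A B : set T) (f : T -> \bar R) :
  (forall x, B x -> 0 <= f x) -> A `<=` B ->
  \int[mu]_(x in A) f x <= \int[mu]_(x in B) f x.
Proof.
move=> f0 AB; rewrite !ge0_integralE//; last by move=> x /AB; exact: f0.
apply: le_ereal_sup => _ [h hA <-]; exists h => // x.
apply: (le_trans (hA x)); rewrite !patchE.
case: ifPn => [/set_mem/AB Bx|_]; first by rewrite mem_set.
by case: ifPn => // /set_mem; exact: f0.
Qed.

End monotone_integral.

Section renewal.
Context {R : realType}.
Local Notation leb := (@lebesgue_measure R).

Lemma measurable_damping (a : R) (D : set R) : measurable D ->
  measurable_fun D (fun s => expR (- (a * s))).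
Proof.
move=> mD; apply: measurableT_comp => //; apply: measurableT_comp => //.
Qed.

(** As n grows, the integrand tends to 0 except at s = 0, a null set. *)
Lemma damped_integral_small (k : R -> R) (T : R) :
  (forall s, 0 <= s -> 0 <= k s) -> leb.-integrable `[0, T] (EFin \o k) ->
  exists n : nat, \int[leb]_(s in `[0, T]) (k s * expR (- (n%:R * s))) <= 2^-1.
Proof.
move=> k0 ik.
have mk : measurable_fun `[0, T] k by case/integrableP : ik => /measurable_EFinP.
have me (n : nat) : measurable_fun (`[0, T] : set R) (fun s => expR (- (n%:R * s))).
  exact: measurable_damping.
have [|||||il H] := @Rintegral_dominated_cvg _ _ R leb `[0, T]
  (fun n s => k s * expR (- (n%:R * s))) (fun s => k s * (s == 0)%:R) k.
- by [].
- by move=> n; apply: measurable_funM => //; exact: measurable_damping.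
- move=> s /=; rewrite in_itv/= => /andP[s0 _]; apply: cvgMr.
  have [->|sn0] := eqVneq s 0.
    by apply: cvg_near_cst; apply: nearW => n; rewrite mulr0 oppr0 expR0.
  under eq_fun do rewrite -mulrN expRM_natl.
  apply: cvg_expr; rewrite ger0_norm ?expR_ge0// -expR0 ltr_expR oppr_lt0.
  by rewrite lt_def sn0.
- by [].
- move=> n s /=; rewrite in_itv/= => /andP[s0 _].
  rewrite normrM (ger0_norm (k0 _ s0)) -[X in _ <= X]mulr1 ler_wpM2l ?k0//.
  by rewrite ger0_norm ?expR_ge0// -expR0 ler_expR oppr_le0 mulr_ge0.
have l0 : \int[leb]_(s in `[0, T]) (k s * (s == 0)%:R) = 0.
  rewrite -Rintegral_itv_obnd_cbnd; last first.
    by apply: integrableS il => //; exact: subset_itv_oc_cc.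
  rewrite (_ : \int[leb]_(x in _) _ = \int[leb]_(x in `]0, T]) 0).
    by rewrite Rintegral_cst// mul0r.
  apply: eq_Rintegral => s; rewrite inE/= in_itv/= => /andP[s0 _].
  by rewrite gt_eqF// mulr0.
move: H; rewrite l0 => /cvgrPdist_le/(_ 2^-1)[]; first by rewrite invr_gt0.
move=> N _ /(_ N) /= /(_ (leqnn N)); rewrite sub0r normrN => HN.
by exists N; apply: le_trans HN; exact: ler_norm.
Qed.

(** With the weight exp(n t), convolution with k becomes a contraction of factor 1/2
for n large.  Iterating the inequality from the crude bound c + B, the excess
over c is at most B 2^-m exp(n t) for every m. *)
Lemma renewal_inequality (y k : R -> R) (T c B : R) :
  0 <= c -> 0 <= B ->
  (forall s, 0 <= s -> 0 <= k s) -> leb.-integrable `[0, T] (EFin \o k) ->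
  \int[leb]_(s in `[0, T]) k s <= 1 ->
  (forall t, 0 <= t <= T -> y t <= c + B) ->
  (forall t, 0 <= t <= T -> leb.-integrable `[0, t] (EFin \o (fun s => y (t - s) * k s))) ->
  (forall t, 0 <= t <= T -> y t <= c \/ y t <= \int[leb]_(s in `[0, t]) (y (t - s) * k s)) ->
  forall t, 0 <= t <= T -> y t <= c.
Proof.
move=> c0 B0 k0 ik k1 yB iy yk.
have [n Hn] := damped_integral_small k0 ik.
have subT t : 0 <= t <= T -> `[0, t] `<=` `[0, T].
  by move=> /andP[_ tT]; apply: subset_itvl; rewrite bnd_simp.
have ikt t : 0 <= t <= T -> leb.-integrable `[0, t] (EFin \o k).
  by move=> tT; apply: integrableS ik => //; exact: subT.
pose ke s := k s * expR (- (n%:R * s)).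
have ke0 s : 0 <= s -> 0 <= ke s by move=> s0; rewrite mulr_ge0 ?expR_ge0 ?k0.
have ike t : 0 <= t <= T -> leb.-integrable `[0, t] (EFin \o ke).
  move=> tT.
  have mk : measurable_fun `[0, t] k by case/integrableP : (ikt _ tT) => /measurable_EFinP.
  apply: le_integrable (ikt _ tT) => //.
    apply/measurable_EFinP; apply: measurable_funM => //; exact: measurable_damping.
  move=> s /=; rewrite in_itv/= => /andP[s0 _]; rewrite lee_fin.
  rewrite normrM -[X in _ <= X]mulr1 ler_wpM2l//.
  by rewrite ger0_norm ?expR_ge0// -expR0 ler_expR oppr_le0 mulr_ge0.
have mono (f : R -> R) t : 0 <= t <= T -> (forall s, 0 <= s -> 0 <= f s) ->
    leb.-integrable `[0, T] (EFin \o f) ->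
    \int[leb]_(s in `[0, t]) f s <= \int[leb]_(s in `[0, T]) f s.
  move=> /andP[t0 tT] f0 fi.
  rewrite -subr_ge0 Rintegral_itvB ?bnd_simp//.
  apply: Rintegral_ge0 => s /=; rewrite in_itv/= => /andP[ts _].
  by apply: f0; rewrite (le_trans t0)// ltW.
(* k has mass at most 1, so the constant c is reproduced by the convolution,
   while the excess is halved *)
have main m t : 0 <= t <= T -> y t <= c + B * 2^-1 ^+ m * expR (n%:R * t).
  elim: m t => [|m ih] t tT.
    rewrite expr0 mulr1; apply: (le_trans (yB _ tT)).
    rewrite lerD2l ler_peMr// -expR0 ler_expR mulr_ge0//.
    by case/andP : tT.
  have p0 : 0 <= 2^-1 ^+ m.+1 :> R by rewrite exprn_ge0// invr_ge0.
  have [yc|{}yk] := yk _ tT.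
    apply: (le_trans yc); rewrite lerDl mulr_ge0 ?expR_ge0// mulr_ge0//.
  apply: (le_trans yk).
  have TT : 0 <= T <= T by case/andP : tT => t0 tT; rewrite (le_trans t0 tT) lexx.
  apply: (@le_trans _ _ (\int[leb]_(s in `[0, t])
      (c * k s + B * 2^-1 ^+ m * expR (n%:R * t) * ke s))).
    apply: le_Rintegral => //; first exact: iy.
      by apply: integrable_add => //; apply: integrable_scale => //;
        [exact: ikt|exact: ike].
    move=> s /=; rewrite in_itv/= => /andP[s0 st].
    have {ih} := ih (t - s); rewrite subr_ge0 st/= => /(_ _)/wrap[].
      by case/andP : tT => _; apply: le_trans; rewrite gerBl.
    move=> ih; apply: (le_trans (ler_wpM2r (k0 _ s0) ih)).
    rewrite mulrBr expRD /ke mulrDl lerD2l le_eqVlt; apply/orP; left; apply/eqP; ring.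
  rewrite RintegralD//; last 2 first.
  - by apply: integrable_scale => //; exact: ikt.
  - by apply: integrable_scale => //; exact: ike.
  rewrite !RintegralZl//; [|exact: ike|exact: ikt].
  apply: lerD.
    by rewrite ler_piMr// (le_trans _ k1)//; exact: mono.
  rewrite exprS (_ : B * (_ * _) * _ = B * 2^-1 ^+ m * expR (n%:R * t) * 2^-1).
    apply: ler_wpM2l.
      by rewrite mulr_ge0 ?expR_ge0// mulr_ge0// exprn_ge0// invr_ge0.
    by apply: le_trans Hn; apply: mono => //; exact: ike.
  by ring.
move=> t tT.
apply/ler_addgt0Pr => e e0.
(* t is fixed now; let m tend to infinity *)
pose A := B * expR (n%:R * t).
have A0 : 0 <= A by rewrite mulr_ge0 ?expR_ge0.
have : A * 2^-1 ^+ m @[m --> \oo] --> A * 0.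
  apply: cvgMr; apply: cvg_expr; rewrite ger0_norm ?invr_ge0//.
  by rewrite invf_lt1// ltr1n.
rewrite mulr0 => /cvgrPdist_le/(_ _ e0)[N _ /(_ N)] /= /(_ (leqnn N)).
rewrite sub0r normrN => HN.
apply: (le_trans (main N t tT)); rewrite lerD2l mulrAC.
by apply: le_trans HN; exact: ler_norm.
Qed.

End renewal.

(** * The integral of the survival function *)

Section mean.
Context {R : realType} (G g : R -> R).
Local Notation leb := (@lebesgue_measure R).
Hypothesis hG : service_distribution G g.

Lemma tail_integral x : 0 <= x ->
  (\int[leb]_(y in `[x, +oo[) (g y)%:E = (1 - G x)%:E)%E.
Proof.
move=> x0; have [mg g0 g1 GE _] := hG.
have ix : leb.-integrable `[x, +oo[ (EFin \o g).
  apply: (integrable_densityS hG) => // y /=; rewrite in_itv/= andbT.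
  exact: le_trans.
rewrite -(fineK (integrable_fin_num _ ix))//; congr EFin.
have := @Rintegral_itvB R g (BLeft 0) (BInfty _ false) x (integrable_density hG).
rewrite !bnd_simp -(cdfE hG x0) => /(_ x0 isT); rewrite {1}/Rintegral g1 => ->.
rewrite Rintegral_itv_obnd_cbnd//.
by apply: integrableS ix => //; apply: subset_itvr; rewrite bnd_simp.
Qed.

(** Tail formula for the mean: exchange the order of integration over the region
0 <= s <= y under the density g y. *)
Lemma integral_survival_le1 t : 0 <= t -> \int[leb]_(s in `[0, t]) (1 - G s) <= 1.
Proof.
move=> t0; have [mg g0 g1 GE mean] := hG.
pose gp : R -> R := g \_ `[0, +oo[.
have gpE y : 0 <= y -> gp y = g y.
  by move=> y0; rewrite /gp patchE mem_set//= in_itv/= y0.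
have gp0 y : 0 <= gp y.
  by rewrite /gp patchE; case: ifPn => // /set_mem/=; rewrite in_itv/= andbT; exact: g0.
have mgp : measurable_fun setT gp by exact/(measurable_restrictT _ _).1.
pose A : set (measurableTypeR R * measurableTypeR R) := [set z | 0 <= z.1 <= z.2].
have mA : measurable A.
  rewrite (_ : A = (fst @^-1` `[0, +oo[) `&` ((fun z => z.2 - z.1) @^-1` `[0, +oo[)).
    apply: measurableI.
      rewrite -[X in measurable X]setTI; exact: measurable_fst.
    rewrite -[X in measurable X]setTI.
    have : measurable_fun setT (fun z : measurableTypeR R * measurableTypeR R => z.2 - z.1).
      by apply: measurable_funB.
    by apply.
  apply/seteqP; split => z; rewrite /A /= !in_itv/= !andbT subr_ge0; by [move=> /andP|case=> -> ->].
pose f (z : measurableTypeR R * measurableTypeR R) : \bar R := (\1_A z * gp z.2)%:E.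
have mf : measurable_fun setT f.
  apply/measurable_EFinP; apply: measurable_funM => //.
  exact: (measurableT_comp mgp).
have f0 z : (0 <= f z)%E by rewrite lee_fin mulr_ge0.
have E1 s : 0 <= s -> (\int[leb]_y f (s, y) = (1 - G s)%:E)%E.
  move=> s0; rewrite -tail_integral// [RHS]integral_mkcond; apply: eq_integral => y _.
  rewrite /f patchE indicE /=; case: (leP s y) => sy.
    rewrite (@mem_set _ A) ?(@mem_set _ `[s, +oo[) /A/= ?s0//= ?in_itv/= ?sy//.
    by rewrite mul1r gpE// (le_trans s0).
  rewrite (@memNset _ A) ?(@memNset _ `[s, +oo[) ?mul0r//= ?in_itv/= ?andbT.
    by apply/negP; rewrite -ltNge.
  by rewrite /A /= s0/=; apply/negP; rewrite -ltNge.
have E2 y : (\int[leb]_s f (s, y) = ((fun y => (y * g y)%:E) \_ `[0%R, +oo[) y)%E.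
  rewrite patchE; case: (leP 0 y) => y0.
    rewrite mem_set/= ?in_itv/= ?y0//.
    rewrite (_ : (fun s => f (s, y)) = (fun s => (g y)%:E * (\1_(`[0%R, y] : set R) s)%:E)%E); last first.
      apply/funext => s; rewrite /f /= gpE// -EFinM; congr EFin.
      have Es : ((s, y) \in A) = (s \in `[0%R, y]%classic).
        by apply/idP/idP => /set_mem/= H; apply/mem_set; move: H; rewrite /A/= in_itv.
      by rewrite [RHS]mulrC !indicE Es.
    rewrite ge0_integralZl//; last 2 first.
    - by apply: measurableT_comp => //; exact: measurable_indic.
    - by rewrite lee_fin g0.
    rewrite integral_indic// setIT.
    rewrite mulrC EFinM; congr (_ * _)%E.
    have := lebesgue_measure_itv `[0, y]; rewrite /= lte_fin.
    move: y0; rewrite le_eqVlt => /predU1P[<-|->]; first by rewrite ltxx.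
    by rewrite oppr0 adde0.
  rewrite memNset/=; last by rewrite in_itv/= andbT; apply/negP; rewrite -ltNge.
  apply: integral0_eq => s _; rewrite /f /= indicE memNset ?mul0r//.
  by rewrite /A /= => /andP[s0 sy]; have := le_lt_trans (le_trans s0 sy) y0; rewrite ltxx.
have F := fubini_tonelli (m1 := leb) (m2 := leb) f mf f0.
have tot : (\int[leb]_s \int[leb]_y f (s, y) = 1)%E.
  rewrite F -mean [RHS]integral_mkcond; apply: eq_integral => y _; exact: E2.
rewrite -lee_fin /Rintegral fineK.
  rewrite -tot (@eq_integral _ _ _ leb _ (fun s => \int[leb]_y f (s, y))%E); last first.
    by move=> s; rewrite inE/= in_itv/= => /andP[s0 _]; rewrite E1.
  apply: ge0_integral_monotone_domain => // s _; exact: integral_ge0.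
have : leb.-integrable `[0, t] (EFin \o (fun s => 1 - G s)).
  have := @continuous_compact_integrable R (fun s => survival G g s) `[0, t] (@segment_compact _ _ _).
  move=> /(_ (continuous_subspaceT (survival_continuous hG))).
  apply: eq_integrable => // s; rewrite inE/= in_itv/= => /andP[s0 _].
  by rewrite survivalE.
exact: integrable_fin_num.
Qed.

End mean.

(** * Comparison of two fluid solutions *)

Lemma difference_balance {R : realType} (p1 p2 a k1 k2 j1 j2 : R) :
  p2 - a * k2 - j2 = p1 - a * k1 - j1 -> p2 - p1 = a * (k2 - k1) + (j2 - j1).
Proof. by move=> H; rewrite mulrBr; lra. Qed.

Lemma departure_balance {R : realType} (p1 p2 m1 m2 d1 d2 i : R) : m1 = m2 ->
  p2 - p1 = 1 * ((p2 - m2 + d2) - (p1 - m1 + d1)) + -1 * i -> d2 - d1 = i.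
Proof. by move=> -> H; lra. Qed.

Section solution.
Context {R : realType} (G g : R -> R).
Local Notation leb := (@lebesgue_measure R).
Local Notation M := (right_end G).
Local Notation h := (hazard G g).
Hypothesis hG : service_distribution G g.
Hypothesis ch : {within ages M, continuous h}.

Lemma hazard_ge0 x : ages M x -> 0 <= h x.
Proof.
move=> /(ages_right_endE hG)[x0 Gx]; rewrite divr_ge0 ?(density_ge0 hG)//.
by rewrite subr_ge0 ltW.
Qed.

Section one_solution.
Variables (E X : R -> R) (nu : R -> subprobability (measurableTypeR R) R).
Hypothesis ini : initial_data M E (X 0) (nu 0).
Hypothesis sol : fluid_solution M h E X nu.
Local Notation D := (departure M h nu).
Local Notation K := (entry M h nu).
Local Notation mass t := (pairing M (cst 1) (nu t)).

Lemma departure_ext_ge0 t : (0 <= departure_ext M h nu t)%E.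
Proof.
apply: integral_ge0 => s _; apply: integral_ge0 => x ax.
by rewrite lee_fin hazard_ge0.
Qed.

Lemma departure_nondecreasing s t : 0 <= s -> s <= t -> D s <= D t.
Proof.
move=> s0 st; have [_ _ fin _ _] := sol; have t0 := le_trans s0 st.
apply: fine_le.
- by rewrite ge0_fin_numE ?fin// departure_ext_ge0.
- by rewrite ge0_fin_numE ?fin// departure_ext_ge0.
apply: ge0_integral_monotone_domain => [u _|].
  by apply: integral_ge0 => x ax; rewrite lee_fin hazard_ge0.
by apply: subset_itvl; rewrite bnd_simp.
Qed.

(** The content equation at time 0 forces this, as E 0 = 0. *)
Lemma departure0 : D 0 = 0.
Proof.
have [_ _ _ _ /(_ 0 (lexx _))[+ _]] := sol; have [[-> _ _] _ _ _] := ini.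
lra.
Qed.

Lemma entry0 : K 0 = 0.
Proof. by rewrite /entry subrr add0r departure0. Qed.

Lemma massE t : 0 <= t -> mass t = Num.min 1 (X t).
Proof.
move=> t0; have [_ _ _ _ /(_ t t0)[_]] := sol.
by case: (leP (1 - X t) 0) => Xt; case: (leP 1 (X t)) => Xt' ?; lra.
Qed.

Lemma content_balance t : 0 <= t -> X t + D t = X 0 + E t.
Proof. by move=> t0; have [_ _ _ _ /(_ t t0)[+ _]] := sol; lra. Qed.

(** Both cases of the minimum are nondecreasing in time, although the mass itself is
not monotone. *)
Lemma entry_minE t : 0 <= t -> K t = Num.min (1 + D t) (X 0 + E t) - mass 0.
Proof.
move=> t0; rewrite /entry (massE t0) -(content_balance t0).
by rewrite -addr_minl; ring.
Qed.

Lemma entry_nondecreasing : {in `[0, +oo[ &, {homo K : x y / x <= y}}.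
Proof.
move=> s t; rewrite !in_itv/= !andbT => s0 t0 st.
rewrite !entry_minE// lerD2r le_min !ge_min.
have [[_ /(_ _ _ s0 st) Est _] _ _ _] := ini.
by rewrite !lerD2l departure_nondecreasing//= Est orbT.
Qed.

End one_solution.

Local Notation gM s := (h s * (1 - G s)).

Lemma density_on_ages_ge0 s : 0 <= s -> 0 <= gM s.
Proof.
move=> s0; rewrite mulr_ge0 ?divr_ge0 ?(density_ge0 hG)// subr_ge0; exact: (cdf_le1 hG).
Qed.

(** Equality holds on the ages; beyond the right end the left side is 0. *)
Lemma density_on_ages_le s : 0 <= s -> gM s <= g s.
Proof.
move=> s0; rewrite /hazard.
have [->|Gs] := eqVneq (1 - G s) 0; first by rewrite mulr0 (density_ge0 hG).
by rewrite divfK.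
Qed.

Lemma C1_bounded_cst : C1_bounded (cst 1 : R -> R) (cst 0).
Proof.
split.
- by move=> x _; apply: is_derive_within.
- by apply: continuous_subspaceT => x; exact: cvg_cst.
- by exists 1; split => // y y1 x _; rewrite /= normr1; exact: ltW.
- by exists 0; split => // y y1 x _; rewrite /= normr0; exact: ltW.
Qed.

Lemma age_kernel_cst s : age_kernel G g (cst 1) (cst 0) s = - gM s.
Proof. by rewrite /age_kernel mul0r mul1r add0r. Qed.

Lemma age_kernel_integrable f f' t : 0 <= t -> C1_bounded f f' ->
  leb.-integrable `[0, t] (EFin \o age_kernel G g f f').
Proof.
move=> t0 hf.
have [] := @kernel_integral_cvg R G g hG ch f f' hf (cst 1) t t0.
  by [].
by move=> + _; apply: eq_integrable => // s _ /=; rewrite mul1r.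
Qed.

Lemma density_on_ages_integrable t : 0 <= t ->
  leb.-integrable `[0, t] (EFin \o (fun s => gM s)).
Proof.
move=> t0; have := integrable_scale (-1) _ (age_kernel_integrable t0 C1_bounded_cst).
move=> /(_ (measurable_itv _)); apply: eq_integrable => // s _ /=.
by rewrite age_kernel_cst mulN1r opprK.
Qed.

Lemma density_on_ages_integral_le1 t : 0 <= t -> \int[leb]_(s in `[0, t]) gM s <= 1.
Proof.
move=> t0; apply: le_trans (cdf_le1 hG t0); rewrite (cdfE hG t0).
apply: le_Rintegral => //; first exact: density_on_ages_integrable.
  exact: (@integrable_density_itv _ _ _ hG).
by move=> s /=; rewrite in_itv/= => /andP[s0 _]; exact: density_on_ages_le.
Qed.

Section two_solutions.
Variables (E1 X1 E2 X2 : R -> R) (nu1 nu2 : R -> subprobability (measurableTypeR R) R).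
Hypothesis ini1 : initial_data M E1 (X1 0) (nu1 0).
Hypothesis sol1 : fluid_solution M h E1 X1 nu1.
Hypothesis ini2 : initial_data M E2 (X2 0) (nu2 0).
Hypothesis sol2 : fluid_solution M h E2 X2 nu2.
Hypothesis nu0 : forall A : set (measurableTypeR R), measurable A -> nu1 0 A = nu2 0 A.

Local Notation K1 := (entry M h nu1).
Local Notation K2 := (entry M h nu2).
Local Notation D1 := (departure M h nu1).
Local Notation D2 := (departure M h nu2).
Local Notation dK := (fun t => entry M h nu2 t - entry M h nu1 t).

Lemma pairing_initial k : pairing M k (nu1 0) = pairing M k (nu2 0).
Proof.
congr fine; apply: eq_measure_integral => A mA _; exact: nu0.
Qed.

(** Subtract the limits obtained for the two solutions: the sequences of initial
terms coincide, hence so do their limits. *)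
Lemma pairing_difference f f' t : 0 <= t -> C1_bounded f f' ->
  leb.-integrable `[0, t] (EFin \o (fun s => dK (t - s) * age_kernel G g f f' s)) /\
  pairing M f (nu2 t) - pairing M f (nu1 t) =
  f 0 * dK t + \int[leb]_(s in `[0, t]) (dK (t - s) * age_kernel G g f f' s).
Proof.
move=> t0 hf.
have [i1 c1] := fluid_trunc_limit hG ch hf t0 sol1 (entry_nondecreasing ini1 sol1) (entry0 ini1 sol1).
have [i2 c2] := fluid_trunc_limit hG ch hf t0 sol2 (entry_nondecreasing ini2 sol2) (entry0 ini2 sol2).
have Ed s : dK (t - s) * age_kernel G g f f' s =
   K2 (t - s) * age_kernel G g f f' s - K1 (t - s) * age_kernel G g f f' s.
  by rewrite mulrBl.
have -> : (fun s => dK (t - s) * age_kernel G g f f' s) = (fun s =>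
   K2 (t - s) * age_kernel G g f f' s - K1 (t - s) * age_kernel G g f f' s).
  by apply/funext.
split; first exact: integrable_sub.
rewrite RintegralB//.
move: c1; under eq_fun do rewrite pairing_initial.
move=> /cvg_lim l1; move: c2 => /cvg_lim l2.
have := l1 (@Rhausdorff _); rewrite (l2 (@Rhausdorff _)).
exact: difference_balance.
Qed.

(** The renewal formula, which is the previous representation for f = 1. *)
Lemma departure_difference t : 0 <= t ->
  leb.-integrable `[0, t] (EFin \o (fun s => dK (t - s) * gM s)) /\
  D2 t - D1 t = \int[leb]_(s in `[0, t]) (dK (t - s) * gM s).
Proof.
move=> t0; have [] := pairing_difference t0 C1_bounded_cst.
have -> : (fun s => dK (t - s) * age_kernel G g (cst 1) (cst 0) s) =
    (fun s => (-1) * (dK (t - s) * gM s)).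
  by apply/funext => s; rewrite age_kernel_cst mulrN mulN1r.
move=> i1; have i2 : leb.-integrable `[0, t] (EFin \o (fun s => dK (t - s) * gM s)).
  have := @integrable_scale _ _ R leb `[0, t] _ (-1) (measurable_itv _) i1.
  by apply: eq_integrable => // s _ /=; rewrite !mulN1r opprK.
rewrite RintegralZl// => H; split => //.
exact: departure_balance (pairing_initial (cst 1)) H.
Qed.

(** If solution 1 is not full at time t, its entries equal X1 0 + E1 t up to the initial
mass, while those of solution 2 never exceed the corresponding quantity.  If
it is full, its mass is at least that of solution 2, so entries are dominated
by departures, which the renewal formula expresses through earlier entries. *)
Lemma comparison (T c : R) : 0 <= c ->
  (forall t, 0 <= t <= T -> (X2 0 - X1 0) + (E2 t - E1 t) <= c) ->
  forall t, 0 <= t <= T -> dK t <= c /\ D2 t - D1 t <= c.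
Proof.
move=> c0 cE.
have [T0|T0] := leP 0 T; last first.
  by move=> t /andP[t0 tT]; have := le_lt_trans (le_trans t0 tT) T0; rewrite ltxx.
have inI (t : R) : 0 <= t -> t \in `[0, +oo[ by rewrite in_itv/= andbT.
have K1ge t : 0 <= t -> 0 <= K1 t.
  move=> t0; rewrite -(entry0 ini1 sol1); apply: entry_nondecreasing ini1 sol1 _ _ _ _ _ => //; exact: inI.
have K2T t : 0 <= t <= T -> K2 t <= K2 T.
  by move=> /andP[t0 tT]; apply: entry_nondecreasing ini2 sol2 _ _ _ _ _ => //; exact: inI.
have HK : forall t, 0 <= t <= T -> dK t <= c.
  apply: (@renewal_inequality _ dK (fun s => gM s) T c (K2 T)) => //.
  - by apply: le_trans (K2T 0 _); rewrite ?lexx// (entry0 ini2 sol2).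
  - exact: density_on_ages_ge0.
  - exact: density_on_ages_integrable.
  - exact: density_on_ages_integral_le1.
  - move=> t tT; have := K2T _ tT; have /andP[t0 _] := tT; have := K1ge _ t0; lra.
  - by move=> t /andP[t0 _]; exact: (departure_difference t0).1.
  move=> t tT; have /andP[t0 _] := tT.
  rewrite -(departure_difference t0).2.
  rewrite /entry pairing_initial (massE sol1 t0) (massE sol2 t0).
  have := cE _ tT; have := content_balance sol1 t0; have := content_balance sol2 t0.
  have : Num.min 1 (X2 t) <= 1 by rewrite ge_min lexx.
  have : Num.min 1 (X2 t) <= X2 t by rewrite ge_min lexx orbT.
  (* right: solution 1 is full; left: it is not *)
  case: (leP 1 (X1 t)) => x1; [right|left]; lra.
move=> t tT; split; first exact: HK.
have /andP[t0 _] := tT; have [id ->] := departure_difference t0.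
apply: (@le_trans _ _ (\int[leb]_(s in `[0, t]) (c * gM s))).
  apply: le_Rintegral => //; first by apply: integrable_scale => //; exact: density_on_ages_integrable.
  move=> s /=; rewrite in_itv/= => /andP[s0 st]; apply: ler_wpM2r; first exact: density_on_ages_ge0.
  apply: HK; rewrite subr_ge0 st/=; case/andP: tT => _; apply: le_trans.
  by rewrite gerBl.
rewrite RintegralZl//; last exact: density_on_ages_integrable.
by rewrite ler_piMr// density_on_ages_integral_le1.
Qed.

(** The constant splits as N for the value at 0, N for the integral of g and N' for
the integral of 1 - G. *)
Lemma pairing_difference_bound f f' (T c N N' : R) : 0 <= T -> C1_bounded f f' ->
  (forall t, 0 <= t <= T -> `|dK t| <= c) ->
  (forall t, 0 <= t <= T -> `|f t| <= N) ->
  (forall t, 0 <= t <= T -> `|f' t| <= N') ->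
  forall t, 0 <= t <= T ->
    `|pairing M f (nu2 t) - pairing M f (nu1 t)| <= (2 * N + N') * c.
Proof.
move=> T0 hf Hc HN HN' t tT; have /andP[t0 tT'] := tT.
have T00 : (0 : R) <= 0 <= T by apply/andP; split.
have c0 := le_trans (normr_ge0 _) (Hc _ T00).
have N0 := le_trans (normr_ge0 _) (HN _ T00).
have N0' := le_trans (normr_ge0 _) (HN' _ T00).
have [id ->] := pairing_difference t0 hf.
have iG : leb.-integrable `[0, t] (EFin \o (fun s => 1 - G s)).
  have := @continuous_compact_integrable R (fun s => survival G g s) `[0, t] (@segment_compact _ _ _).
  move=> /(_ (continuous_subspaceT (survival_continuous hG))).
  apply: eq_integrable => // s; rewrite inE/= in_itv/= => /andP[s0 _].
  by rewrite survivalE.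
have iO := density_on_ages_integrable t0.
have B : \int[leb]_(s in `[0, t]) (c * (N' * (1 - G s) + N * gM s)) <= c * (N' + N).
  rewrite RintegralZl//; last by apply: integrable_add => //; apply: integrable_scale.
  rewrite ler_wpM2l// RintegralD//; try by apply: integrable_scale.
  rewrite !RintegralZl//; apply: lerD; rewrite ler_piMr//.
    exact: (integral_survival_le1 hG t0).
  exact: density_on_ages_integral_le1.
apply: (le_trans (ler_normD _ _)).
rewrite (_ : (2 * N + N') * c = N * c + c * (N' + N)); last by ring.
apply: lerD.
  by rewrite normrM ler_pM// ?HN ?Hc.
apply: (le_trans (le_normr_Rintegral _ id)) => //; apply: le_trans B.
apply: le_Rintegral => //; first exact: integrable_norm.
  by apply: integrable_scale => //; apply: integrable_add => //; apply: integrable_scale.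
move=> s /=; rewrite in_itv/= => /andP[s0 st]; rewrite normrM ler_pM//.
  apply: Hc; rewrite subr_ge0 st/=; apply: le_trans tT'.
  by rewrite gerBl.
have sT : 0 <= s <= T by rewrite s0 (le_trans st).
apply: (le_trans (ler_normB _ _)); apply: lerD.
  rewrite normrM ler_pM ?HN'// ger0_norm// subr_ge0; exact: (cdf_le1 hG).
by rewrite normrM ler_pM ?HN// ger0_norm// density_on_ages_ge0.
Qed.

End two_solutions.
End solution.

(** * Suprema over a time interval and the main estimate *)

Section sup_upto.
Context {R : realType}.
Implicit Types (T B c : R) (k : R -> R).

(** Bounded functions have a finite supremum, which allows the extended-real
estimates to be read off real ones. *)
Lemma sup_upto_fin T B k : 0 <= T -> (forall t, 0 <= t <= T -> k t <= B) ->
  exists2 s, sup_upto T k = s%:E & forall t, 0 <= t <= T -> k t <= s.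
Proof.
move=> T0 kB.
have ub t : 0 <= t <= T -> ((k t)%:E <= sup_upto T k)%E.
  by move=> tT; apply: ereal_sup_ubound; exists t => //=; rewrite in_itv.
have fin : sup_upto T k \is a fin_num.
  rewrite fin_numElt; apply/andP; split.
    by apply: lt_le_trans (ub 0 _); rewrite ?ltNyr// lexx.
  apply: (@le_lt_trans _ _ B%:E); rewrite ?ltry//.
  by apply: ge_ereal_sup => _ [t + <-]; rewrite /= in_itv/= lee_fin; exact: kB.
exists (fine (sup_upto T k)); first by rewrite fineK.
by move=> t tT; rewrite -lee_fin fineK// ub.
Qed.

Lemma sup_upto_le T c k : (forall t, 0 <= t <= T -> k t <= c) ->
  (sup_upto T k <= c%:E)%E.
Proof.
move=> kc; apply: ge_ereal_sup => _ [t + <-].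
by rewrite /= in_itv/= lee_fin; exact: kc.
Qed.

End sup_upto.

Section input.
Context {R : realType}.
Implicit Types (M : \bar R) (E : R -> R).

Lemma input_bounds M E x mu T t : initial_data M E x mu ->
  0 <= t <= T -> 0 <= E t <= E T.
Proof.
move=> [[E0 Emono _] _ _ _] /andP[t0 tT].
by rewrite -[X in X <= _]E0 !Emono.
Qed.

Lemma difference_bounds (a b A B : R) :
  0 <= a <= A -> 0 <= b <= B -> b - a <= B /\ `|b - a| <= A + B.
Proof.
move=> /andP[a0 aA] /andP[b0 bB]; split; first by lra.
by rewrite ler_norml; apply/andP; split; lra.
Qed.

End input.

Theorem theorem4p5 (R : realType) (G g E1 E2 X1 X2 : R -> R)
    (nu1 nu2 : R -> subprobability (measurableTypeR R) R) :
  let M := right_end G in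
  let h := hazard G g in
  let dK := fun t => entry M h nu2 t - entry M h nu1 t in
  let dD := fun t => departure M h nu2 t - departure M h nu1 t in
  let dE := fun t => E2 t - E1 t in
  let dX := fun t => X2 t - X1 t in
  service_distribution G g ->
  {within ages M, continuous h} ->
  initial_data M E1 (X1 0) (nu1 0) -> fluid_solution M h E1 X1 nu1 ->
  initial_data M E2 (X2 0) (nu2 0) -> fluid_solution M h E2 X2 nu2 ->
  (forall A : set (measurableTypeR R), measurable A -> nu1 0 A = nu2 0 A) ->
  (forall T : R, 0 <= T ->
     (maxe (sup_upto T dK) (sup_upto T dD)
        <= maxe ((dX 0)%:E + sup_upto T dE) 0)%E /\
     (maxe (norm_upto T dK) (norm_upto T dD)
        <= `|dX 0|%:E + norm_upto T dE)%E) /\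
  (forall (T : R) (f f' : R -> R), 0 <= T -> C1_bounded f f' ->
     (norm_upto T (fun s => pairing M f (nu2 s) - pairing M f (nu1 s))%R
        <= (2%:E * norm_upto T f + norm_upto T f')
           * (`|dX 0|%:E + norm_upto T dE))%E).
Proof.
move=> M h dK dD dE dX hG ch ini1 sol1 ini2 sol2 nu0.
have nu0' A : measurable A -> nu2 0 A = nu1 0 A by move=> /nu0.
have dE_bounds T t : 0 <= t <= T -> dE t <= E2 T /\ `|dE t| <= E1 T + E2 T.
  by move=> tT; exact: difference_bounds (input_bounds ini1 tT) (input_bounds ini2 tT).
have dE_norm T : 0 <= T ->
    exists2 n, norm_upto T dE = n%:E & forall t, 0 <= t <= T -> `|dE t| <= n.
  move=> T0; apply: (@sup_upto_fin _ _ (E1 T + E2 T)) => // t tT.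
  exact: (dE_bounds _ _ tT).2.
have abs_bound T n : 0 <= T -> (forall t, 0 <= t <= T -> `|dE t| <= n) ->
    forall t, 0 <= t <= T -> `|dK t| <= `|dX 0| + n /\ `|dD t| <= `|dX 0| + n.
  move=> T0 Hn t tT.
  have c0 : 0 <= `|dX 0| + n by rewrite addr_ge0// (le_trans _ (Hn t tT)).
  have [|k1 d1] := comparison hG ch ini1 sol1 ini2 sol2 nu0 c0 _ tT.
    by move=> s sT; apply: lerD; [exact: ler_norm|apply: le_trans (Hn s sT); exact: ler_norm].
  (* the lower bounds follow by exchanging the two solutions *)
  have [|k2 d2] := comparison hG ch ini2 sol2 ini1 sol1 nu0' c0 _ tT.
    move=> s sT; apply: lerD; first by rewrite -normrN /dX opprB; exact: ler_norm.
    by apply: le_trans (Hn s sT); rewrite -normrN /dE opprB; exact: ler_norm.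
  by rewrite /dK /dD !ler_norml; split; apply/andP; split=> //; rewrite lerNl opprB.
split=> [T T0|T f f' T0 hf].
- split.
    have [s sE Hs] : exists2 s, sup_upto T dE = s%:E & forall t, 0 <= t <= T -> dE t <= s.
      by apply: (@sup_upto_fin _ _ (E2 T)) => // t tT; exact: (dE_bounds _ _ tT).1.
    rewrite sE -EFinD -EFin_max.
    have c0 : 0 <= Num.max (dX 0 + s) 0 by rewrite le_max lexx orbT.
    have H t : 0 <= t <= T -> dK t <= Num.max (dX 0 + s) 0 /\ dD t <= Num.max (dX 0 + s) 0.
      apply: (comparison hG ch ini1 sol1 ini2 sol2 nu0 c0) => u uT.
      by rewrite le_max; apply/orP; left; rewrite lerD2l; exact: Hs.
    by rewrite ge_max !sup_upto_le// => t /H[].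
  have [n nE Hn] := dE_norm T T0.
  by rewrite nE -EFinD ge_max !sup_upto_le// => t tT; have [] := abs_bound _ _ T0 Hn t tT.
- have [n nE Hn] := dE_norm T T0.
  have [_ _ /bounded_on[C _ HC] /bounded_on[C' _ HC']] := hf.
  have [N NE HN] : exists2 N, norm_upto T f = N%:E & forall t, 0 <= t <= T -> `|f t| <= N.
    by apply: (@sup_upto_fin _ _ C) => // t /andP[t0 _]; exact: HC.
  have [N' NE' HN'] : exists2 N, norm_upto T f' = N%:E & forall t, 0 <= t <= T -> `|f' t| <= N.
    by apply: (@sup_upto_fin _ _ C') => // t /andP[t0 _]; exact: HC'.
  rewrite nE NE NE' -[leRHS]/((2 * N + N') * (`|dX 0| + n))%:E; apply: sup_upto_le => t tT.
  apply: (pairing_difference_bound hG ch ini1 sol1 ini2 sol2 nu0 T0 hf _ HN HN' tT).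
  by move=> s sT; have [] := abs_bound _ _ T0 Hn s sT.
Qed.
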